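(* Let $W:\mathbb{R}^N\to(-\infty,+\infty]$ satisfy: (1) $W$ is bounded from below; (2) $W$ is lower semicontinuous; (3) there exists $M>0$ such that $\int_{B(x,1)}W(y)\,dy\le M$ for all $x\in\mathbb{R}^N$; (4) there exists $C^*>0$ such that $\Delta^{\epsilon}W(x)<C^*$ for all $x\in\mathbb{R}^N$ and all $\epsilon\in(0,1)$. Let $\mu\in\mathcal{P}(\mathbb{R}^N)$ be a compactly supported local minimizer of the interaction energy $E_W$ with respect to the topology induced by $d_\infty$. If $W$ is $\beta$-repulsive at the origin for some $0<\beta<N$, then for every part $\rho$ of $\mu$, the Hausdorff dimension of $\mathrm{supp}(\rho)$ is greater than or equal to $\beta$.
   Context: $\mathcal{P}(\mathbb{R}^N)$ is the set of Borel probability measures on $\mathbb{R}^N$; $\mathrm{supp}(\mu)=\{x:\mu(B(x,\epsilon))>0\ \forall\epsilon>0\}$. Interaction energy: $E_W[\mu]=\frac12\iint_{\mathbb{R}^N\times\mathbb{R}^N}W(x-y)\,d\mu(x)\,d\mu(y)$. Distance $d_\infty$: $d_\infty(\mu,\nu)=\inf_{\pi\in\Pi(\mu,\nu)}\sup_{(x,y)\in\mathrm{supp}(\pi)}|x-y|\in[0,+\infty]$, where $\Pi(\mu,\nu)$ is the set of Borel probability measures on $\mathbb{R}^N\times\mathbb{R}^N$ with marginals $\mu$ and $\nu$. A measure $\mu\in\mathcal{P}(\mathbb{R}^N)$ is a local minimizer of $E_W$ with respect to $d_\infty$ if there is $\delta>0$ such that $E_W[\mu]\le E_W[\nu]$ for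 all $\nu\in\mathcal{P}(\mathbb{R}^N)$ with $d_\infty(\mu,\nu)<\delta$. Part: a nonnegative Borel measure $\rho$ on $\mathbb{R}^N$ is a part of $\mu$ if $\rho$ is not identically zero and $\rho(A)\le\mu(A)$ for all Borel sets $A$. Approximate and generalized Laplacians: for $W$ locally integrable and $\epsilon>0$, $$-\Delta^{\epsilon}W(x)=\frac{2(N+2)}{\epsilon^2}\left(W(x)-\frac{1}{|B(0,\epsilon)|}\int_{B(0,\epsilon)}W(x+y)\,dy\right),\qquad -\Delta^0W(x)=\liminf_{n\to\infty}\left\{-\Delta^{(1/n)}W(x)\right\}.$$ $\beta$-repulsive: $W$ (locally integrable) is $\beta$-repulsive at the origin if there exist $\epsilon>0$ and $C>0$ such that $-\Delta^0W(x)\ge C/|x|^{\beta}$ for all $0<|x|<\epsilon$, and $-\Delta^0W(0)=+\infty$. *)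

(* Defs.v *)
From HB Require Import structures.
From mathcomp Require Import all_boot all_order all_algebra.
From mathcomp Require Import all_classical all_reals all_analysis.
From mathcomp Require Import measurable_realfun.

Set Implicit Arguments.
Unset Strict Implicit.
Unset Printing Implicit Defensive.
Import Order.TTheory GRing.Theory Num.Theory.
Import numFieldTopology.Exports numFieldNormedType.Exports.

Local Open Scope classical_set_scope.
Local Open Scope ring_scope.

(* R^N is 'rV[R]_N. The topology is the library's (product) topology, but the
   library's norm on matrices is the sup norm, so that the Euclidean norm,
   balls and diameters are defined explicitly. *)
Definition enorm (R : realType) (N : nat) (x : 'rV[R]_N) : R :=
  Num.sqrt (\sum_(i < N) x ord0 i ^+ 2).

Definition eball (R : realType) (N : nat) (x : 'rV[R]_N) (r : R) :
    set 'rV[R]_N :=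
  [set y | enorm (y - x) < r].

(* Borel sigma-algebra. The product sigma-algebra that the library puts on
   'rV[R]_N * 'rV[R]_N is then the Borel one, as 'rV[R]_N is second
   countable. *)
HB.instance Definition _ (R : realType) (m n : nat) :=
  Measurable.copy 'M[R]_(m, n) (g_sigma_algebraType (@open 'M[R]_(m, n))).

Lemma open_measurable_mx (R : realType) m n (A : set 'M[R]_(m, n)) :
  open A -> measurable A.
Proof. exact: sub_sigma_algebra. Qed.

Lemma measurable_coord (R : realType) N (i : 'I_N) :
  measurable_fun setT (fun x : 'rV[R]_N => x ord0 i).
Proof.
apply: (measurability _ (RGenOpens.measurableE R)).
move=> _ [_ [a [b ->]] <-]; rewrite setTI; apply: open_measurable_mx.
apply: open_comp; last exact: interval_open.
by move=> x _; exact: coord_continuous.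
Qed.

(* Every open set is a countable union of balls with rational centre. *)
Lemma measurable_fun_rV d (T : measurableType d) (R : realType) N
    (f : T -> 'rV[R]_N) :
  (forall i, measurable_fun setT (fun t => f t ord0 i)) ->
  measurable_fun setT f.
Proof.
move=> mf; apply: (@measurability _ _ _ _ setT f (@open 'rV[R]_N)) => //.
move=> _ [U oU <-]; rewrite setTI.
pose B (q : 'rV[rat]_N * nat) :=
  [set x : 'rV[R]_N | forall i, `|x ord0 i - ratr (q.1 ord0 i)| < q.2.+1%:R^-1].
have -> : f @^-1` U = \bigcup_(q in [set q | B q `<=` U]) (f @^-1` B q).
  apply/seteqP; split => [t /= Uft|t [q /= BU Bft]]; last exact: BU.
  have [e /= e0 eU] : nbhs_ball (f t) U by apply/nbhs_ballP; exact: open_nbhs_nbhs.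
  pose k := Num.truncn (2 / e).
  have k0 : (0 : R) < k.+1%:R^-1 by rewrite invr_gt0.
  have ke : k.+1%:R^-1 < e / 2.
    by rewrite -[ltRHS]invrK ltf_pV2 ?posrE ?invr_gt0 ?divr_gt0// invf_div truncnS_gt.
  have Hq i : exists q : rat, `|f t ord0 i - ratr q| < k.+1%:R^-1.
    have /rat_in_itvoo[q] : f t ord0 i - k.+1%:R^-1 < f t ord0 i + k.+1%:R^-1.
      by rewrite ltrBlDr -addrA ltrDl addr_gt0.
    by rewrite in_itv/= -ltr_distl distrC => ?; exists q.
  have [q Pq] := choice Hq.
  exists (\row_i q i, k) => /=; last by move=> i; rewrite mxE.
  move=> x /= Bx; apply: eU; split => // i j; rewrite ord1 /ball/=.
  have := Bx j; rewrite mxE => xq.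
  rewrite (le_lt_trans (ler_distD (ratr (q j)) _ _))// [ltRHS]splitr ltrD//.
    by rewrite (lt_trans (Pq j)).
  by rewrite distrC (lt_trans xq).
rewrite bigcup_mkcond; apply: countable_bigcupT_measurable => // q.
case: ifP => _; last exact: measurable0.
rewrite (_ : _ @^-1` _ = \bigcap_(i in [set: 'I_N])
    ((fun t => f t ord0 i) @^-1` ball (ratr (q.1 ord0 i) : R) q.2.+1%:R^-1)).
  apply: fin_bigcap_measurable => // i _.
  rewrite -[X in measurable X]setTI; apply: mf => //.
  by apply: open_measurable; exact: ball_open.
by apply/seteqP; split => t /= h i; [move=> _|]; have := h i;
  rewrite /ball/= distrC //; exact.
Qed.

Definition rV_cons (R : realType) N (p : 'rV[R]_N * R) : 'rV[R]_N.+1 :=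
  row_mx (const_mx p.2 : 'rV[R]_1) p.1.

Lemma measurable_rV_cons (R : realType) N : measurable_fun setT (@rV_cons R N).
Proof.
apply: measurable_fun_rV => i.
case: (splitP (i : 'I_(1 + N))) => j ij.
  have -> : (fun t => @rV_cons R N t ord0 i) = snd; last exact: measurable_snd.
  apply/funext => t; rewrite /rV_cons (_ : i = lshift N j); last exact/val_inj.
  by rewrite [LHS]row_mxEl mxE.
have -> : (fun t => @rV_cons R N t ord0 i) = (fun x : 'rV[R]_N => x ord0 j) \o fst.
  apply/funext => t; rewrite /rV_cons (_ : i = rshift 1 j); last exact/val_inj.
  by rewrite [LHS]row_mxEr.
by apply: measurableT_comp; [exact: measurable_coord|exact: measurable_fst].
Qed.

(* N-dimensional Lebesgue measure on the Borel sets, by iterated products;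
   lebesgue_rV_box gives its value on boxes, which characterizes it. *)
Fixpoint lebesgue_rV (R : realType) (N : nat) :
    {measure set 'rV[R]_N -> \bar R} :=
  match N with
  | 0 => dirac (0 : 'rV[R]_0)
  | n.+1 => measure_function_pushforward__canonical__measure_function_Measure
      (product_measure1 (lebesgue_rV R n) (@lebesgue_measure R))
      (@measurable_rV_cons R n)
  end.

Lemma lebesgue_rV_box (R : realType) N (A : 'I_N -> set R) :
  (forall i, measurable (A i)) ->
  lebesgue_rV R N [set x | forall i, A i (x ord0 i)] =
  (\prod_(i < N) lebesgue_measure (A i))%E.
Proof.
elim: N A => [|n IHn] A mA.
  rewrite big_ord0 /= diracE mem_set//=; by case.
rewrite big_ord_recl muleC -IHn//.
have mbox :
    measurable [set x : 'rV[R]_n | forall i, A (lift ord0 i) (x ord0 i)].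
  rewrite (_ : [set x : 'rV[R]_n | _] = \bigcap_(i in [set: 'I_n])
      ((fun x : 'rV[R]_n => x ord0 i) @^-1` A (lift ord0 i))).
    apply: fin_bigcap_measurable => // i _.
    by rewrite -[X in measurable X]setTI; exact: measurable_coord.
  by apply/seteqP; split => x /= h i; [move=> _|]; exact: h.
rewrite -(@product_measure1E _ _ _ _ _ (lebesgue_rV R n))//; last exact: (mA ord0).
rewrite /= /pushforward; congr (product_measure1 _ _ _).
have E0 (p : 'rV[R]_n * R) : rV_cons p ord0 ord0 = p.2.
  rewrite /rV_cons (_ : ord0 = lshift n (ord0 : 'I_1)); last exact/val_inj.
  by rewrite [LHS]row_mxEl mxE.
have ES (p : 'rV[R]_n * R) j : rV_cons p ord0 (lift ord0 j) = p.1 ord0 j.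
  rewrite /rV_cons (_ : lift ord0 j = rshift 1 j); last exact/val_inj.
  by rewrite [LHS]row_mxEr.
apply/seteqP; split => p /=.
  by move=> h; split => [i|]; [rewrite -ES|rewrite -E0]; exact: h.
by move=> [h1 h0] i; case: (unliftP ord0 i) => [j|] ->; rewrite ?E0 ?ES.
Qed.

Definition locally_integrable_rV (R : realType) (N : nat)
    (W : 'rV[R]_N -> \bar R) :=
  measurable_fun setT W /\
  forall K : set 'rV[R]_N, compact K ->
    (\int[lebesgue_rV R N]_(y in K) `|W y| < +oo)%E.

(* -Delta^e W; the factor 2(N+2)/e^2 makes it converge to -Delta W as e -> 0
   when W is smooth. *)
Definition approx_neg_laplacian (R : realType) (N : nat) (e : R)
    (W : 'rV[R]_N -> \bar R) (x : 'rV[R]_N) : \bar R :=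
  ((2 * (N%:R + 2) / e ^+ 2)%:E *
   (W x - ((fine (lebesgue_rV R N (eball 0 e)))^-1)%:E *
          \int[lebesgue_rV R N]_(y in eball 0 e) W (x + y)%R))%E.

(* -Delta^0 W; the index n stands for 1/(n+1). *)
Definition neg_laplacian0 (R : realType) (N : nat) (W : 'rV[R]_N -> \bar R)
    (x : 'rV[R]_N) : \bar R :=
  limn_einf (fun n : nat => approx_neg_laplacian (n.+1%:R^-1) W x).

Definition beta_repulsive (R : realType) (N : nat) (beta : R)
    (W : 'rV[R]_N -> \bar R) :=
  [/\ locally_integrable_rV W,
      exists e C : R, [/\ 0 < e, 0 < C &
        forall x : 'rV[R]_N, 0 < enorm x < e ->
          ((C / enorm x `^ beta)%:E <= neg_laplacian0 W x)%E] &
      neg_laplacian0 W 0 = +oo%E].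

Definition interaction_energy (R : realType) (N : nat)
    (W : 'rV[R]_N -> \bar R) (mu : probability 'rV[R]_N R) : \bar R :=
  ((2^-1)%:E * \int[mu \x mu]_p W (p.1 - p.2)%R)%E.

Definition supp (R : realType) (N : nat) (mu : set 'rV[R]_N -> \bar R) :
    set 'rV[R]_N :=
  [set x | forall e : R, 0 < e -> (0 < mu (eball x e))%E].

(* Same notion on R^N x R^N = R^(2N), with its Euclidean balls. *)
Definition supp2 (R : realType) (N : nat)
    (p : set ('rV[R]_N * 'rV[R]_N) -> \bar R) : set ('rV[R]_N * 'rV[R]_N) :=
  [set z | forall e : R, 0 < e ->
    (0 < p [set w | Num.sqrt (enorm (w.1 - z.1) ^+ 2 + enorm (w.2 - z.2) ^+ 2)
                    < e]%R)%E].

Definition couplings (R : realType) (N : nat) (mu nu : probability 'rV[R]_N R) :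
    set (probability ('rV[R]_N * 'rV[R]_N)%type R) :=
  [set p | forall A : set 'rV[R]_N, measurable A ->
     p (A `*` setT) = mu A /\ p (setT `*` A) = nu A].

Definition dinfty (R : realType) (N : nat) (mu nu : probability 'rV[R]_N R) :
    \bar R :=
  ereal_inf [set ereal_sup [set (enorm (z.1 - z.2))%:E | z in supp2 p]
            | p in couplings mu nu].

Definition dinfty_local_minimizer (R : realType) (N : nat)
    (W : 'rV[R]_N -> \bar R) (mu : probability 'rV[R]_N R) :=
  exists2 d : R, 0 < d & forall nu : probability 'rV[R]_N R,
    (dinfty mu nu < d%:E)%E ->
    (interaction_energy W mu <= interaction_energy W nu)%E.

Definition is_part (R : realType) (N : nat)
    (rho : {measure set 'rV[R]_N -> \bar R}) (mu : probability 'rV[R]_N R) :=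
  (exists2 A, measurable A & rho A != 0%E) /\
  (forall A, measurable A -> (rho A <= mu A)%E).

Definition diam (R : realType) (N : nat) (U : set 'rV[R]_N) : \bar R :=
  ereal_sup [set (enorm (z.1 - z.2))%:E | z in U `*` U].

(* diam(U)^s, with the convention that the empty set contributes 0 also when
   s = 0 (the supremum of the empty set is -oo in \bar R). *)
Definition diam_pow (R : realType) (N : nat) (s : R) (U : set 'rV[R]_N) :
    \bar R :=
  if U == set0 then 0%E else (diam U `^ s)%E.

(* Unnormalized Hausdorff measures: the constant does not affect dimension. *)
Definition hausdorff_content (R : realType) (N : nat) (s d : R)
    (A : set 'rV[R]_N) : \bar R :=
  ereal_inf [set (\sum_(0 <= i <oo) diam_pow s (U i))%E
            | U in [set U : nat -> set 'rV[R]_N |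
                A `<=` \bigcup_i U i /\ forall i, (diam (U i) <= d%:E)%E]].

Definition hausdorff_measure (R : realType) (N : nat) (s : R)
    (A : set 'rV[R]_N) : \bar R :=
  ereal_sup [set hausdorff_content s d A | d in [set d : R | 0 < d]].

Definition hausdorff_dim (R : realType) (N : nat) (A : set 'rV[R]_N) : \bar R :=
  ereal_inf [set s%:E | s in [set s : R | 0 <= s /\ hausdorff_measure s A = 0%E]].

(* Main.v *)
Require Import Defs.
From mathcomp Require Import all_boot all_order all_algebra.
From mathcomp Require Import all_classical all_reals all_analysis.
From mathcomp Require Import measurable_realfun.
From mathcomp Require Import ring lra.
Set Implicit Arguments.
Unset Strict Implicit.
Unset Printing Implicit Defensive.
Import Order.TTheory GRing.Theory Num.Theory.
Import numFieldTopology.Exports numFieldNormedType.Exports.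
Local Open Scope classical_set_scope.
Local Open Scope ring_scope.

(** The energy of a minimizer cannot be lowered by spreading a little of its mass uniformly over
small balls. This makes its potential sub-harmonic in the mean on its support, while the
repulsion of the kernel makes the potential strongly super-harmonic wherever mass concentrates;
the two are compatible only if small balls carry little mass, and a measure whose balls of
radius r have mass O(r^beta) cannot live on a set of dimension below beta.

Write F = W + k >= 0, let U be the uniform law on the ball of radius e, and let V(x) be the
integral of F(x - y) + F(y - x) against mu(dy). The kernel may fail to be even, so V, and not
F * mu, is the first variation of the energy. For a Borel set A, let kappa be the law of
X + 1_A(X) Y with X ~ mu and Y ~ U. Mass moves by at most e, so that (1 - t) mu + t kappa is
within d_oo distance e of mu (dinfty_mixture), and its energy is a quadratic polynomial in t
(cross_mixture). The bound on the integrals of W over unit balls makes the energy of mu and that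
of kappa finite, and the derivative at t = 0 says that the integral of V against mu is at most
that against kappa (cross_first_variation). Choosing for A the set where V exceeds its mean over
the ball of radius e forces mu(A) = 0, hence V(x) <= mean of V over B(x, e) for mu-almost every x
(sympot_sub_mean).

By Tonelli, the difference between V and its mean is, up to a factor, the integral of
approximate Laplacians of W, which are bounded below by -C. Thus the integral of
-Delta^e W(x - y) + C against mu(dy) is at most 2 C (integral_laplacian_le), for all e = 1/n with
n large, and Fatou's lemma passes to -Delta^0 W (minimizer_laplacian_le). Since this integrand
dominates c |x - y|^(-beta) near the diagonal and is +oo on it, mu(B(x, r)) <= (2 C / c) r^beta
(frostman), an estimate inherited by every part of mu. The mass distribution principle
(mass_distribution) then shows that the s-dimensional Hausdorff measure of the support of a part
is nonzero for every s < beta. *)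

(** * Euclidean norm *)

Section euclidean.
Context {R : realType} {N : nat}.
Implicit Types x y z : 'rV[R]_N.

Lemma enorm_ge0 x : 0 <= enorm x. Proof. exact: sqrtr_ge0. Qed.

Lemma sqr_enorm x : enorm x ^+ 2 = \sum_(i < N) x ord0 i ^+ 2.
Proof. by rewrite sqr_sqrtr// sumr_ge0// => i _; exact: sqr_ge0. Qed.

Lemma enormN x : enorm (- x) = enorm x.
Proof. by congr Num.sqrt; apply: eq_bigr => i _; rewrite mxE sqrrN. Qed.

Lemma enorm0 : enorm (0 : 'rV[R]_N) = 0.
Proof.
by rewrite /enorm big1 ?sqrtr0// => i _; rewrite mxE expr0n.
Qed.

Lemma enormBC x y : enorm (x - y) = enorm (y - x).
Proof. by rewrite -enormN opprB. Qed.

Lemma coord_le_enorm x i : `|x ord0 i| <= enorm x.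
Proof.
rewrite -sqrtr_sqr ler_wsqrtr// (bigD1 i)//= lerDl sumr_ge0// => j _.
exact: sqr_ge0.
Qed.

Lemma enorm_eq0 x : enorm x = 0 -> x = 0.
Proof.
move=> x0; apply/rowP => i; rewrite mxE; apply/eqP.
by rewrite -normr_le0 -x0 coord_le_enorm.
Qed.

Lemma enorm_le_sum x : enorm x <= \sum_(i < N) `|x ord0 i|.
Proof.
have s0 : 0 <= \sum_(i < N) `|x ord0 i| by exact: sumr_ge0.
rewrite -[leRHS]ger0_norm// -sqrtr_sqr ler_wsqrtr// expr2 mulr_suml.
apply: ler_sum => i _; rewrite -real_normK ?num_real// expr2 ler_wpM2l//.
by rewrite (bigD1 i)//= lerDl sumr_ge0.
Qed.

(** With a = |x| and b = |y|, this is the sum over i of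
2 a b x_i y_i <= (b x_i)^2 + (a y_i)^2, divided by 2 a b. *)
Lemma cauchy_schwarz x y :
  \sum_(i < N) x ord0 i * y ord0 i <= enorm x * enorm y.
Proof.
have [/enorm_eq0->|xn0] := eqVneq (enorm x) 0.
  by rewrite enorm0 mul0r big1// => i _; rewrite mxE mul0r.
have [/enorm_eq0->|yn0] := eqVneq (enorm y) 0.
  by rewrite enorm0 mulr0 big1// => i _; rewrite mxE mulr0.
have ab0 : 0 < enorm x * enorm y by rewrite mulr_gt0// lt_def ?xn0 ?yn0 enorm_ge0.
rewrite -(ler_pM2l ab0) -(ler_pM2l (ltr0n R 2)).
rewrite [leRHS](_ : _ = enorm y ^+ 2 * enorm x ^+ 2 + enorm x ^+ 2 * enorm y ^+ 2); last ring.
rewrite [in X in _ <= X + _](sqr_enorm x) [in X in _ <= _ + X](sqr_enorm y).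
rewrite !mulr_sumr -big_split/=; apply: ler_sum => i _.
rewrite -subr_ge0 [leRHS](_ : _ = (enorm y * x ord0 i - enorm x * y ord0 i) ^+ 2) ?sqr_ge0//.
ring.
Qed.

Lemma enormD x y : enorm (x + y) <= enorm x + enorm y.
Proof.
rewrite -(@ler_pXn2r _ 2)// ?nnegrE ?addr_ge0 ?enorm_ge0//.
rewrite sqrrD !sqr_enorm -!addrA.
have -> : \sum_(i < N) (x + y) ord0 i ^+ 2 = \sum_(i < N) x ord0 i ^+ 2 +
    (2 * (\sum_(i < N) x ord0 i * y ord0 i) + \sum_(i < N) y ord0 i ^+ 2).
  by rewrite mulr_sumr -!big_split/=; apply: eq_bigr => i _; rewrite mxE; ring.
by have := cauchy_schwarz x y; lra.
Qed.

Lemma measurable_enorm : measurable_fun setT (@enorm R N).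
Proof.
have -> : @enorm R N = Num.sqrt \o (fun x => \sum_(i < N) x ord0 i ^+ 2) by [].
apply: measurableT_comp; first by apply: continuous_measurable_fun; exact: sqrt_continuous.
apply: measurable_sum => i; apply: measurable_funX; exact: measurable_coord.
Qed.

Lemma measurable_subrV : measurable_fun setT (fun p : 'rV[R]_N * 'rV[R]_N => p.1 - p.2).
Proof.
apply: measurable_fun_rV => i.
under eq_fun do rewrite !mxE.
by apply: measurable_funB; apply: (measurableT_comp (measurable_coord i));
  [exact: measurable_fst|exact: measurable_snd].
Qed.

Lemma measurable_addrV : measurable_fun setT (fun p : 'rV[R]_N * 'rV[R]_N => p.1 + p.2).
Proof.
apply: measurable_fun_rV => i.
under eq_fun do rewrite !mxE.
by apply: measurable_funD; apply: (measurableT_comp (measurable_coord i));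
  [exact: measurable_fst|exact: measurable_snd].
Qed.

Section measurable_operations.
Context d (T : measurableType d) (f g : T -> 'rV[R]_N).
Hypotheses (mf : measurable_fun setT f) (mg : measurable_fun setT g).

Lemma measurable_rVB : measurable_fun setT (fun t => f t - g t).
Proof.
apply: (measurableT_comp measurable_subrV (g := fun t => (f t, g t))).
exact: measurable_fun_pair.
Qed.

Lemma measurable_rVD : measurable_fun setT (fun t => f t + g t).
Proof.
apply: (measurableT_comp measurable_addrV (g := fun t => (f t, g t))).
exact: measurable_fun_pair.
Qed.

End measurable_operations.

Lemma measurable_rVN : measurable_fun setT (fun x => - x).
Proof.
under eq_fun do rewrite -sub0r.
exact: measurable_rVB.
Qed.

Definition cball x r := [set y | enorm (y - x) <= r].

Lemma measurable_eball x r : measurable (eball x r).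
Proof.
rewrite /eball -[X in measurable X]setTI.
apply: measurable_fun_ltr (measurable_cst r) _ _ _ => //.
by apply: (measurableT_comp measurable_enorm); exact: measurable_rVB.
Qed.

Lemma measurable_cball x r : measurable (cball x r).
Proof.
rewrite /cball -[X in measurable X]setTI.
apply: measurable_fun_ler (measurable_cst r) _ _ _ => //.
by apply: (measurableT_comp measurable_enorm); exact: measurable_rVB.
Qed.

End euclidean.

(** * Lebesgue measure: invariance, volume of balls, uniform laws *)

Lemma lebesgue_measureD (R : realType) (v : R) (A : set R) : measurable A ->
  lebesgue_measure ((fun t => t + v) @^-1` A) = lebesgue_measure A.
Proof.
move=> mA.
have mv : measurable_fun setT ((fun t => t + v) : measurableTypeR R -> measurableTypeR R).
  exact: measurable_funD.
apply/esym.
have := @lebesgue_measure_unique R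
  (measure_function_pushforward__canonical__measure_function_Measure lebesgue_measure mv).
apply => // _ [[a b]] _ <-.
rewrite /= /pushforward.
have -> : (fun t => t + v) @^-1` [set` `]a, b]] = [set` `](a - v), (b - v)]].
  by apply/seteqP; split => t /=; rewrite !in_itv/= ltrBlDr lerBrDr.
by rewrite !lebesgue_measure_itv/= !lte_fin ltrD2r -!EFinB opprB addrA subrK.
Qed.

Lemma rV_cons0 (R : realType) n (p : 'rV[R]_n * R) : rV_cons p ord0 ord0 = p.2.
Proof.
rewrite /rV_cons (_ : ord0 = lshift n (ord0 : 'I_1)); last exact/val_inj.
by rewrite [LHS]row_mxEl mxE.
Qed.

Lemma rV_consS (R : realType) n (p : 'rV[R]_n * R) j :
  rV_cons p ord0 (lift ord0 j) = p.1 ord0 j.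
Proof.
rewrite /rV_cons (_ : lift ord0 j = rshift 1 j); last exact/val_inj.
by rewrite [LHS]row_mxEr.
Qed.

(** Carrying the sign s along lets one induction on the dimension treat both the translations,
which relate balls with different centres, and the reflection x -> -x, which exchanges the two
arguments of the kernel. *)
Lemma lebesgue_rV_isometry (R : realType) (N : nat) (s : bool) (v : 'rV[R]_N)
    (A : set 'rV[R]_N) : measurable A ->
  lebesgue_rV R N ((fun x => (-1) ^+ s *: x + v) @^-1` A) = lebesgue_rV R N A.
Proof.
elim: N v A => [|n IH] v A mA.
  have eqA B : B = 0 :> 'rV[R]_0 by apply/rowP => -[].
  rewrite [_ @^-1` _](_ : _ = A)//.
  by apply/seteqP; split => x /=; rewrite (eqA x) (eqA (_ + _)).
pose v' : 'rV[R]_n := \row_i v ord0 (lift ord0 i).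
pose g (x : 'rV[R]_n) := (-1) ^+ s *: x + v'.
have mg : measurable_fun setT g.
  apply: measurable_rVD => //; apply: measurable_fun_rV => i.
  under eq_fun do rewrite mxE.
  by apply: measurable_funM => //; exact: measurable_coord.
pose B := @rV_cons R n @^-1` A.
have mB : measurable B by rewrite -[B]setTI; exact: measurable_rV_cons.
rewrite [RHS]/= /pushforward -/B /product_measure1.
transitivity (\int[lebesgue_rV R n]_x
    (lebesgue_measure \o xsection B) (g x))%E; last first.
  rewrite -[LHS](@ge0_integral_pushforward _ _ _ _ _ _ mg (lebesgue_rV R n) setT
    (lebesgue_measure \o xsection B))//.
    apply: eq_measure_integral => C mC _; exact: IH.
  exact: measurable_fun_xsection.
rewrite [LHS]/= /pushforward /product_measure1; apply: eq_integral => x _ /=.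
have mS y : measurable (xsection B y) by exact: measurable_xsection.
transitivity (lebesgue_measure ((fun t => (-1) ^+ s * t + v ord0 ord0) @^-1`
    xsection B (g x))).
  congr lebesgue_measure; apply/seteqP; rewrite /B.
  have E t : (-1) ^+ s *: rV_cons (x, t) + v =
      rV_cons (g x, (-1) ^+ s * t + v ord0 ord0).
    apply/rowP => i; rewrite 2!mxE.
    by case: (unliftP ord0 i) => [j|] ->; rewrite ?rV_cons0 ?rV_consS ?mxE.
  by split => t /=; rewrite /xsection/= !inE/= E.
(* In dimension one the two cases are a reflection followed by a translation, and a translation. *)
case: s @g IH mg => g _ _ /=.
  rewrite expr1.
  rewrite -(lebesgue_measureD (v ord0 ord0) (mS _)).
  rewrite -(lebesgue_measureN (A := (fun t => t + v ord0 ord0) @^-1` _))/pushforward//.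
    by congr lebesgue_measure; apply/seteqP; split => t /=; rewrite mulN1r.
  rewrite -[X in measurable X]setTI; exact: measurable_funD.
rewrite expr0 -[RHS](lebesgue_measureD (v ord0 ord0) (mS _)).
by congr lebesgue_measure; apply/seteqP; split => t /=; rewrite mul1r.
Qed.

Lemma ge0_integral_mrestr d (T : measurableType d) (R : realType)
    (m : {measure set T -> \bar R}) (D : set T) (mD : measurable D) (f : T -> \bar R) :
  measurable_fun setT f -> (forall x, 0 <= f x)%E ->
  (\int[mrestr m mD]_x f x = \int[m]_(x in D) f x)%E.
Proof.
move=> mf f0; rewrite -(setUv D) ge0_integral_setU//; last 3 first.
- exact: measurableC.
- exact: measurable_funTS.
- exact/disj_setPCl.
rewrite [X in (_ + X)%E](_ : _ = 0%E) ?adde0.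
  by apply: eq_measure_integral => A mA AD; rewrite /= /mrestr setIidl.
rewrite (eq_measure_integral mzero) ?integral_measure_zero// => A mA AD.
by rewrite /= /mrestr (_ : A `&` D = set0) ?measure0//; apply/disjoints_subset.
Qed.

Lemma probability_of_measure d (T : measurableType d) (R : realType)
    (m : {measure set T -> \bar R}) : m setT = 1%E ->
  exists P : probability T R, forall A, P A = m A.
Proof.
move=> m1; exists (mnormalize m (dirac point)) => A.
by rewrite /= /mnormalize m1 onee_eq0/= invr1 mule1.
Qed.

Section ball_volume.
Context {R : realType} {N : nat}.
Implicit Types (x : 'rV[R]_N) (e : R).

Lemma measurable_box (A : 'I_N -> set R) : (forall i, measurable (A i)) ->
  measurable [set x : 'rV[R]_N | forall i, A i (x ord0 i)].
Proof.
move=> mA; rewrite (_ : [set x | _] = \bigcap_(i in [set: 'I_N])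
    ((fun x : 'rV[R]_N => x ord0 i) @^-1` A i)).
  apply: fin_bigcap_measurable => // i _.
  by rewrite -[X in measurable X]setTI; exact: measurable_coord.
by apply/seteqP; split => x /= h i; [move=> _|]; exact: h.
Qed.

Lemma lebesgue_eball_center x e :
  lebesgue_rV R N (eball x e) = lebesgue_rV R N (eball 0 e).
Proof.
rewrite -(@lebesgue_rV_isometry _ _ false x (eball x e)); last exact: measurable_eball.
congr (lebesgue_rV R N _); apply/seteqP; rewrite /eball.
by split => y /=; rewrite expr0 scale1r subr0 addrK.
Qed.

Lemma lebesgue_eball_lty e : (lebesgue_rV R N (eball 0 e) < +oo)%E.
Proof.
pose A (_ : 'I_N) : set R := [set` `]-e, e[].
have mbox : measurable [set x : 'rV[R]_N | forall i, A i (x ord0 i)].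
  by apply: measurable_box => i; exact: measurable_itv.
apply: (@le_lt_trans _ _ (lebesgue_rV R N [set x | forall i, A i (x ord0 i)])).
  apply: le_measure; rewrite ?inE//; first exact: measurable_eball.
  move=> x /=; rewrite /eball/= subr0 => xe i.
  by rewrite /A/= in_itv/= -ltr_norml (le_lt_trans (coord_le_enorm _ _)).
rewrite lebesgue_rV_box//; last by move=> i; exact: measurable_itv.
suff : (\prod_(i < N) lebesgue_measure (A i))%E \is a fin_num.
  by rewrite ge0_fin_numE// prode_ge0.
apply: (big_ind (fun z : \bar R => z \is a fin_num)) => //.
  exact: fin_numM.
by move=> i _; rewrite /A lebesgue_measure_itv/=; case: ifP.
Qed.

Lemma lebesgue_eball_gt0 e : 0 < e -> (0 < lebesgue_rV R N (eball 0 e))%E.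
Proof.
move=> e0.
(* The cube of half-side c lies in the ball, as the sum of N coordinates at most c is below e. *)
pose c := e / N.+1%:R.
have c0 : 0 < c by rewrite divr_gt0.
pose A (_ : 'I_N) : set R := [set` `]-c, c[].
have mbox : measurable [set x : 'rV[R]_N | forall i, A i (x ord0 i)].
  by apply: measurable_box => i; exact: measurable_itv.
apply: (@lt_le_trans _ _ (lebesgue_rV R N [set x | forall i, A i (x ord0 i)])).
  rewrite lebesgue_rV_box//; last by move=> i; exact: measurable_itv.
  apply: (big_ind (fun z : \bar R => 0 < z)%E) => //.
    exact: mule_gt0.
  move=> i _; rewrite /A lebesgue_measure_itv/= lte_fin gtrN// -EFinB lte_fin.
  by rewrite opprK addr_gt0.
apply: le_measure; rewrite ?inE//; first exact: measurable_eball.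
move=> x /= xA; rewrite /eball/= subr0 (le_lt_trans (enorm_le_sum _))//.
apply: (@le_lt_trans _ _ (\sum_(i < N) c)).
  apply: ler_sum => i _; have := xA i.
  by rewrite /A/= in_itv/= -ltr_norml => /ltW.
rewrite sumr_const card_ord -mulr_natr /c mulrAC -mulrA gtr_pMr//.
by rewrite ltr_pdivrMr// mul1r ltr_nat.
Qed.

Lemma eball0_opp (x : 'rV[R]_N) e : eball 0 e (- x) = eball 0 e x.
Proof. by rewrite /eball/= !subr0 enormN. Qed.

Lemma ge0_integral_invariant (lam : {measure set 'rV[R]_N -> \bar R})
    (phi : 'rV[R]_N -> 'rV[R]_N) (B B' : set 'rV[R]_N) (f : 'rV[R]_N -> \bar R) :
  measurable_fun setT phi ->
  (forall A, measurable A -> lam (phi @^-1` A) = lam A) ->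
  measurable B -> phi @^-1` B = B' ->
  measurable_fun setT f -> (forall x, 0 <= f x)%E ->
  (\int[lam]_(x in B') f (phi x) = \int[lam]_(x in B) f x)%E.
Proof.
move=> mphi lamphi mB BB' mf f0.
transitivity (\int[pushforward lam phi]_(x in B) f x)%E.
  rewrite (ge0_integral_pushforward mphi)//; last exact: measurable_funTS.
  by rewrite BB'.
by apply: eq_measure_integral => // A mA _; exact: lamphi.
Qed.

(** The uniform law on a ball, packaged as a probability so that the product theorems for
finite measures apply to it. *)
Lemma uniform_eball e : 0 < e -> exists U : probability 'rV[R]_N R,
  [/\ U (~` eball 0 e) = 0%E,
      forall f : 'rV[R]_N -> \bar R, measurable_fun setT f -> (forall x, 0 <= f x)%E ->
        (\int[U]_x f x = ((fine (lebesgue_rV R N (eball 0 e)))^-1)%:E *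
           \int[lebesgue_rV R N]_(x in eball 0 e) f x)%E &
      forall f : 'rV[R]_N -> \bar R, measurable_fun setT f -> (forall x, 0 <= f x)%E ->
        (\int[U]_x f (- x)%R = \int[U]_x f x)%E].
Proof.
move=> e0; set B := eball 0 e; have mB : measurable B by exact: measurable_eball.
set lam := lebesgue_rV R N.
have B0 : 0 < fine (lam B) by rewrite fine_gt0// lebesgue_eball_gt0// lebesgue_eball_lty.
have Bfin : lam B \is a fin_num by rewrite ge0_fin_numE// lebesgue_eball_lty.
have k0 : 0 <= (fine (lam B))^-1 by rewrite invr_ge0 ltW.
pose m := mscale (NngNum k0) (mrestr lam mB).
have [U UE] : exists U : probability 'rV[R]_N R, forall A, U A = m A.
  apply: probability_of_measure.
  rewrite /= /mscale /= /mrestr setTI -[X in (_ * X)%E]fineK// -EFinM mulVf//.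
  by rewrite gt_eqF.
have Uint f : measurable_fun setT f -> (forall x, 0 <= f x)%E ->
    (\int[U]_x f x = ((fine (lam B))^-1)%:E * \int[lam]_(x in B) f x)%E.
  move=> mf f0; rewrite -(ge0_integral_mrestr lam mB)//.
  rewrite -[RHS](@ge0_integral_mscale _ _ _ (mrestr lam mB) _ measurableT (NngNum k0))//.
  apply: eq_measure_integral => A mA _; exact: UE.
exists U; split => //.
  by rewrite UE /m/= /mscale/= /mrestr setICl measure0 mule0.
move=> f mf f0; rewrite !Uint//; last exact: measurableT_comp mf measurable_rVN.
congr (_ * _)%E.
apply: (@ge0_integral_invariant lam (fun x => - x)%R) => //.
- exact: measurable_rVN.
- move=> A mA; rewrite -[RHS](@lebesgue_rV_isometry _ _ true 0)//.
  by congr (lam _); apply/seteqP; split => x /=; rewrite expr1 scaleN1r addr0.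
- by apply/funext => x; exact: eball0_opp.
Qed.

Lemma integral_eball_center (f : 'rV[R]_N -> \bar R) (z : 'rV[R]_N) (r : R) :
  measurable_fun setT f -> (forall x, 0 <= f x)%E ->
  (\int[lebesgue_rV R N]_(y in eball 0%R r) f (z + y)%R =
   \int[lebesgue_rV R N]_(y in eball z r) f y)%E.
Proof.
move=> mf f0; apply: (@ge0_integral_invariant _ (fun y => z + y)%R) => //.
- exact: measurable_rVD.
- move=> A mA; rewrite -[RHS](@lebesgue_rV_isometry _ _ false z)//.
  by congr (lebesgue_rV R N _); apply/seteqP; split => x /=; rewrite expr0 scale1r addrC.
- exact: measurable_eball.
- by apply/seteqP; rewrite /eball; split => x /=; rewrite subr0 addrAC subrr add0r.
Qed.

End ball_volume.

(** * Integrals, mixtures and images of probabilities *)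

Section integral_complements.
Context d (T : measurableType d) (R : realType).
Local Open Scope ereal_scope.

(** Both sides may be +oo: the identity f + k + f^- = f^+ + k reduces the claim to additivity for
nonnegative functions, and the integral of f^- is at most k m(D). *)
Lemma integral_shift (m : {measure set T -> \bar R}) (D : set T) (f : T -> \bar R)
    (k : R) : measurable D -> m D < +oo -> measurable_fun D f -> (0 <= k)%R ->
  (forall x, (- k)%:E <= f x) ->
  \int[m]_(x in D) f x = \int[m]_(x in D) (f x + k%:E) - k%:E * m D.
Proof.
move=> mD Dfin mf k0 fk.
have mDfin : m D \is a fin_num by rewrite ge0_fin_numE.
have g0 x : 0 <= f x + k%:E by rewrite -leeBlDr// sub0e; exact: fk.
have mg : measurable_fun D (fun x => f x + k%:E).
  by apply: emeasurable_funD.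
have negk x : f^\- x <= k%:E.
  by rewrite funenegE ge_max leeNl fk lee_fin k0.
have Eint : \int[m]_(x in D) (f x + k%:E) + \int[m]_(x in D) f^\- x =
    \int[m]_(x in D) f^\+ x + k%:E * m D.
  rewrite -(integral_cst m mD) -!ge0_integralD//; last 2 first.
  - exact: measurable_funepos.
  - exact: measurable_funeneg.
  apply: eq_integral => x _ /=; rewrite funeposE funenegE.
  have := fk x; case: (f x) => [r| |]//= _; last by rewrite max_r ?leNye// max_l ?leey.
  rewrite -!EFin_max -!EFinD; congr EFin.
  have [r0|r0] := leP 0%R r.
    have r0' : (- r <= 0)%R by rewrite oppr_le0.
    by rewrite (max_r r0') addr0.
  have r0' : (0 <= - r)%R by rewrite oppr_ge0 ltW.
  by rewrite (max_l r0'); ring.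
have nfin : \int[m]_(x in D) f^\- x \is a fin_num.
  rewrite ge0_fin_numE ?integral_ge0//.
  apply: (@le_lt_trans _ _ (k%:E * m D)); last first.
    by rewrite -(fineK mDfin) -EFinM ltry.
  rewrite -(integral_cst m mD); apply: ge0_le_integral => //.
  exact: measurable_funeneg.
rewrite integralE.
have kmfin : k%:E * m D \is a fin_num by rewrite -(fineK mDfin).
have c0 : 0 <= \int[m]_(x in D) f^\+ x by exact: integral_ge0.
have a0 : 0 <= \int[m]_(x in D) (f x + k%:E) by exact: integral_ge0.
move: c0 a0 Eint.
move: (\int[m]_(x in D) f^\+ x) (\int[m]_(x in D) (f x + _)).
move: nfin kmfin => /fineK <- /fineK <-.
by move=> [c| |] [a| |]//= _ _ [?]; rewrite -!EFinB; congr EFin; lra.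
Qed.

Lemma mixture (P Q : probability T R) (t : R) : (0 <= t <= 1)%R ->
  exists M : probability T R,
    (forall A, M A = (1 - t)%:E * P A + t%:E * Q A) /\
    forall f : T -> \bar R, measurable_fun setT f -> (forall x, 0 <= f x) ->
      \int[M]_x f x = (1 - t)%:E * \int[P]_x f x + t%:E * \int[Q]_x f x.
Proof.
move=> /andP[t0 t1]; have t1' : (0 <= 1 - t)%R by rewrite subr_ge0.
pose m := measure_add (mscale (NngNum t1') P) (mscale (NngNum t0) Q).
have mE A : m A = (1 - t)%:E * P A + t%:E * Q A by rewrite /m measure_addE.
have [M ME] : exists M : probability T R, forall A, M A = m A.
  apply: probability_of_measure.
  by rewrite [LHS]mE !probability_setT !mule1 -EFinD subrK.
exists M; split => [A|f mf f0]; first by rewrite ME mE.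
rewrite (eq_measure_integral m); last by move=> A mA _; exact: ME.
rewrite ge0_integral_measure_add//.
by rewrite (ge0_integral_mscale P measurableT (NngNum t1'))//
  (ge0_integral_mscale Q measurableT (NngNum t0)).
Qed.

Lemma pushforward_probability d' (T' : measurableType d') (P : probability T R)
    (f : T -> T') : measurable_fun setT f ->
  exists Q : probability T' R,
    (forall A, Q A = P (f @^-1` A)) /\
    forall g : T' -> \bar R, measurable_fun setT g -> (forall x, 0 <= g x) ->
      \int[Q]_y g y = \int[P]_x g (f x).
Proof.
move=> mf.
have [Q QE] : exists Q : probability T' R, forall A, Q A = P (f @^-1` A).
  apply: (@probability_of_measure _ _ _
    (measure_function_pushforward__canonical__measure_function_Measure P mf)).
  exact: probability_setT.
exists Q; split => // g mg g0.
transitivity (\int[pushforward P f]_y g y).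
  by apply: eq_measure_integral => // A _ _; exact: QE.
by rewrite (ge0_integral_pushforward mf).
Qed.

End integral_complements.

(** * Couplings and displacements *)

Section couplings.
Context {R : realType} {N : nat}.
Local Notation V := 'rV[R]_N.
Implicit Types mu nu kappa U : probability V R.

Definition far (r : R) : set (V * V) := [set w | r < enorm (w.1 - w.2)].

Lemma measurable_far r : measurable (far r).
Proof.
rewrite /far -[X in measurable X]setTI.
apply: (measurable_fun_ltr (measurable_cst r)) => //.
exact: measurableT_comp measurable_enorm measurable_subrV.
Qed.

(** Far pairs form an open set, so that the support of a coupling which does not charge this set
avoids it. *)
Lemma dinfty_le mu nu (p : probability (V * V)%type R) (r : R) :
  couplings mu nu p -> p (far r) = 0%E -> (dinfty mu nu <= r%:E)%E.
Proof.
move=> cp p0; apply: ge_ereal_inf; exists (ereal_sup [set (enorm (z.1 - z.2))%:E | z in supp2 p]).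
  by exists p.
apply: ge_ereal_sup => _ [z zp <-]; rewrite lee_fin leNgt; apply/negP => rz.
(* Moving both points by less than half the excess keeps them far apart. *)
pose e := (enorm (z.1 - z.2) - r) / 2.
have e0 : 0 < e by rewrite divr_gt0// subr_gt0.
have := zp e e0; rewrite ltNge => /negP; apply.
rewrite -p0; apply: le_measure; rewrite ?inE; [|exact: measurable_far|].
  rewrite -[X in measurable X]setTI.
  apply: (measurable_fun_ltr _ (measurable_cst e)) => //.
  have -> : (fun w : V * V => Num.sqrt (enorm (w.1 - z.1) ^+ 2 + enorm (w.2 - z.2) ^+ 2)) =
    Num.sqrt \o (fun w => enorm (w.1 - z.1) ^+ 2 + enorm (w.2 - z.2) ^+ 2) by [].
  apply: measurableT_comp; first by apply: continuous_measurable_fun; exact: sqrt_continuous.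
  apply: measurable_funD; apply: measurable_funX;
    apply: (measurableT_comp measurable_enorm); exact: measurable_rVB.
move=> w /= we.
have w1 : enorm (w.1 - z.1) < e.
  apply: le_lt_trans we; rewrite -[leLHS]ger0_norm ?enorm_ge0// -sqrtr_sqr.
  by rewrite ler_wsqrtr// lerDl sqr_ge0.
have w2 : enorm (w.2 - z.2) < e.
  apply: le_lt_trans we; rewrite -[leLHS]ger0_norm ?enorm_ge0// -sqrtr_sqr.
  by rewrite ler_wsqrtr// lerDr sqr_ge0.
have : enorm (z.1 - z.2) <= enorm (z.1 - w.1) + enorm (w.1 - w.2) + enorm (w.2 - z.2).
  have -> : z.1 - z.2 = (z.1 - w.1) + (w.1 - w.2) + (w.2 - z.2).
    by rewrite !addrA !subrK.
  by rewrite (le_trans (enormD _ _))// lerD2r enormD.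
rewrite (enormBC z.1 w.1) /far/= => zw; rewrite /e in w1 w2; lra.
Qed.

(** Mixing the given coupling with the diagonal coupling of mu with itself couples mu with the
mixture, without creating far pairs. *)
Lemma dinfty_mixture mu kappa nu (p : probability (V * V)%type R) (r t : R) :
  0 <= r -> 0 <= t <= 1 -> couplings mu kappa p -> p (far r) = 0%E ->
  (forall A, measurable A -> nu A = (1 - t)%:E * mu A + t%:E * kappa A)%E ->
  (dinfty mu nu <= r%:E)%E.
Proof.
move=> r0 t01 cp p0 nuE.
have [q [qE _]] := @pushforward_probability _ _ R _ _ mu (fun x : V => (x, x))
  (measurable_fun_pair (@measurable_id _ _ _) (@measurable_id _ _ _)).
have [m [mE _]] := mixture q p t01.
apply: (@dinfty_le _ _ m).
  move=> A mA; rewrite !mE !qE (cp A mA).1 (cp A mA).2 nuE//.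
  have -> : (fun x : V => (x, x)) @^-1` (A `*` setT) = A.
    by apply/seteqP; split => x //= -[].
  have -> : (fun x : V => (x, x)) @^-1` (setT `*` A) = A.
    by apply/seteqP; split => x //= -[].
  split=> //; rewrite -muleDl//; last exact: fin_num_measure.
  by rewrite -EFinD subrK mul1e.
rewrite mE p0 mule0 adde0 qE (_ : _ @^-1` _ = set0) ?measure0 ?mule0//.
by apply/seteqP; split => x //=; rewrite /far/= subrr enorm0 ltNge r0.
Qed.

Definition displace (A : set V) (w : V * V) : V := w.1 + (\1_A w.1 : R) *: w.2.

Lemma measurable_displace A : measurable A -> measurable_fun setT (displace A).
Proof.
move=> mA; apply: measurable_rVD; first exact: measurable_fst.
apply: measurable_fun_rV => i; under eq_fun do rewrite mxE.
apply: measurable_funM; last exact: measurableT_comp (measurable_coord i) measurable_snd.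
apply: measurableT_comp measurable_fst.
exact: measurable_indic.
Qed.

Lemma displaceE A x y : displace A (x, y) = if x \in A then x + y else x.
Proof.
by rewrite /displace/= indicE; case: (x \in A); rewrite ?scale1r// scale0r addr0.
Qed.

(** A competitor for mu: each point x of A is replaced by a uniform point of the ball around x,
so that the coupling with mu is supported by pairs at distance at most e. *)
Lemma displacement mu U (A : set V) (e : R) : 0 <= e -> measurable A ->
  U (~` eball 0 e) = 0%E ->
  exists (kappa : probability V R) (p : probability (V * V)%type R),
    [/\ couplings mu kappa p, p (far e) = 0%E &
    forall f : V -> \bar R, measurable_fun setT f -> (forall x, 0 <= f x)%E ->
      (\int[kappa]_x f x = \int[mu]_x \int[U]_y f (displace A (x, y)))%E].
Proof.
move=> e0 mA U0; have mD := measurable_displace mA.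
have prodE (B C : set V) : measurable B -> measurable C ->
    ((mu \x U) (B `*` C) = mu B * U C)%E.
  by move=> mB mC; exact: product_measure1E.
have [kappa [kE kint]] := pushforward_probability (mu \x U)%E mD.
have mDp : measurable_fun setT (fun w => (w.1, displace A w)).
  by apply: measurable_fun_pair => //; exact: measurable_fst.
have [p [pE _]] := pushforward_probability (mu \x U)%E mDp.
exists kappa, p; split.
- move=> B mB; rewrite !pE kE; split; last first.
    by congr ((mu \x U)%E _); apply/seteqP; split => -[x y] //= [].
  rewrite (_ : _ @^-1` _ = B `*` setT); last by apply/seteqP; split => -[x y] /= [].
  by rewrite [LHS]prodE// probability_setT mule1.
- rewrite pE.
  have mE : measurable (~` eball (0 : V) e) by apply: measurableC; exact: measurable_eball.
  apply: (@subset_measure0 _ _ _ (mu \x U)%E _ (setT `*` ~` eball 0%R e)); last first.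
  + by rewrite [LHS]prodE// U0 mule0.
  + move=> [x y]; rewrite /far /= displaceE => xy; split => //= ey.
    move: xy; rewrite ltNge => /negP; apply; case: ifP => _.
      by rewrite opprD addrA subrr add0r enormN ltW//; move: ey; rewrite /eball/= subr0.
    by rewrite subrr enorm0.
  + exact: measurableX.
  + rewrite -[X in measurable X]setTI; apply: (mDp measurableT); exact: measurable_far.
- move=> f mf f0; rewrite kint// fubini_tonelli1//.
  exact: measurableT_comp mf mD.
Qed.

End couplings.

(** * Mutual energies and their first variation *)

(** Compare the coefficients of t as t -> 0: t = min(1, eta / (2 (|K - J + L| + 1))) with
eta = 2 K - J would contradict the hypothesis. *)
Lemma first_order (R : realFieldType) (K J L : R) :
  (forall t, 0 < t <= 1 -> K <= (1 - t) ^+ 2 * K + (1 - t) * t * J + t ^+ 2 * L) ->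
  2 * K <= J.
Proof.
move=> H; rewrite leNgt; apply/negP => JK.
pose c := `|K - J + L| + 1.
have c0 : 0 < c by rewrite ltr_pwDr.
have cK : K - J + L <= c by rewrite (le_trans (ler_norm _))// lerDl.
pose t := Num.min 1 ((2 * K - J) / (2 * c)).
have t0 : 0 < t.
  by rewrite lt_min ltr01/= divr_gt0 ?subr_gt0// mulr_gt0.
have t1 : t <= 1 by rewrite ge_min lexx.
have tc : t * (2 * c) <= 2 * K - J.
  by rewrite -ler_pdivlMr ?mulr_gt0// ge_min lexx orbT.
have := H t; rewrite t0 t1 => /(_ isT) Ht.
have : t * (2 * K - J) <= t * (t * (K - J + L)) by nra.
rewrite ler_pM2l// => Ht'.
have : t * (K - J + L) <= t * c by rewrite ler_pM2l.
by move=> ?; nra.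
Qed.

Section variation.
Context {R : realType} {N : nat}.
Local Notation V := 'rV[R]_N.
Implicit Types mu nu kappa U : probability V R.
Local Open Scope ereal_scope.
Variables (F : V -> \bar R).
Hypotheses (mF : measurable_fun setT F) (F0 : forall x, 0 <= F x).

(** The kernel F may fail to be even, so there are two potentials and an asymmetric mutual
energy. *)
Definition pot (b : probability V R) (x : V) := \int[b]_y F (x - y)%R.
Definition copot (a : probability V R) (y : V) := \int[a]_x F (x - y)%R.
Definition cross (a b : probability V R) := \int[a]_x pot b x.

Let mFB : measurable_fun setT (fun p : V * V => F (p.1 - p.2)%R).
Proof. exact: measurableT_comp mF measurable_subrV. Qed.

Lemma measurable_sub_l (x : V) : measurable_fun setT (fun y : V => F (x - y)%R).
Proof. by apply: measurableT_comp mF _; exact: measurable_rVB. Qed.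

Lemma measurable_sub_r (y : V) : measurable_fun setT (fun x : V => F (x - y)%R).
Proof. by apply: measurableT_comp mF _; exact: measurable_rVB. Qed.

Lemma pot_ge0 b x : 0 <= pot b x. Proof. exact: integral_ge0. Qed.
Lemma copot_ge0 b x : 0 <= copot b x. Proof. exact: integral_ge0. Qed.

Lemma measurable_pot nu : measurable_fun setT (pot nu).
Proof. exact: (measurable_fun_fubini_tonelli_F (fun p : V * V => F (p.1 - p.2)%R)). Qed.

Lemma measurable_copot nu : measurable_fun setT (copot nu).
Proof. exact: (measurable_fun_fubini_tonelli_G (fun p : V * V => F (p.1 - p.2)%R)). Qed.

Lemma crossC mu nu : cross mu nu = \int[nu]_y copot mu y.
Proof. exact: (fubini_tonelli (fun p : V * V => F (p.1 - p.2)%R)). Qed.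

Lemma cross_ge0 mu nu : 0 <= cross mu nu.
Proof. by apply: integral_ge0 => x _; exact: pot_ge0. Qed.

Lemma prob_cst nu (c : \bar R) : \int[nu]_x c = c.
Proof.
transitivity (c * nu setT); first exact: integral_cst.
by rewrite probability_setT mule1.
Qed.

Lemma cross_mixture mu kappa nu (t : R) : (0 <= t <= 1)%R ->
  (forall f : V -> \bar R, measurable_fun setT f -> (forall x, 0 <= f x) ->
    \int[nu]_x f x = (1 - t)%:E * \int[mu]_x f x + t%:E * \int[kappa]_x f x) ->
  cross nu nu = (1 - t)%:E * ((1 - t)%:E * cross mu mu + t%:E * cross mu kappa) +
    t%:E * ((1 - t)%:E * cross kappa mu + t%:E * cross kappa kappa).
Proof.
move=> /andP[t0 t1] nuE; have t1' : (0 <= 1 - t)%R by rewrite subr_ge0.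
have potE x : pot nu x = (1 - t)%:E * pot mu x + t%:E * pot kappa x.
  by rewrite /pot nuE//; exact: measurable_sub_l.
have crossE (a : probability V R) :
    cross a nu = (1 - t)%:E * cross a mu + t%:E * cross a kappa.
  rewrite /cross; under eq_integral do rewrite potE.
  rewrite ge0_integralD//; last 4 first.
  - by move=> x _; rewrite mule_ge0 ?lee_fin ?pot_ge0.
  - by apply: measurable_funeM; exact: measurable_pot.
  - by move=> x _; rewrite mule_ge0 ?lee_fin ?pot_ge0.
  - by apply: measurable_funeM; exact: measurable_pot.
  by rewrite !ge0_integralZl//; try exact: measurable_pot; move=> x _; exact: pot_ge0.
rewrite {1}/cross nuE; [|exact: measurable_pot|by move=> x; exact: pot_ge0].
by rewrite -/(cross _ _) -/(cross _ _) !crossE.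
Qed.

Section displaced_measure.
Variables (mu U kappa : probability V R) (A : set V).
Hypothesis mA : measurable A.
Hypothesis kappaE : forall f : V -> \bar R, measurable_fun setT f -> (forall x, 0 <= f x) ->
  \int[kappa]_x f x = \int[mu]_x \int[U]_y f (displace A (x, y)).

Lemma integral_displaced (f : V -> \bar R) : measurable_fun setT f -> (forall x, 0 <= f x) ->
  \int[kappa]_x f x =
  \int[mu]_x (if x \in A then \int[U]_y f (x + y)%R else f x).
Proof.
move=> mf f0; rewrite kappaE//; apply: eq_integral => x _.
under eq_integral do rewrite displaceE.
by case: ifP => // _; rewrite prob_cst.
Qed.

(** Points outside A contribute to the integral of f against mu, points of A at most the uniform
bound M on the means of f. *)
Lemma integral_displaced_le (f : V -> \bar R) (M : \bar R) :
  measurable_fun setT f -> (forall x, 0 <= f x) -> 0 <= M ->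
  (forall z, \int[U]_y f (z + y)%R <= M) ->
  \int[kappa]_x f x <= M + \int[mu]_x f x.
Proof.
move=> mf f0 M0 fM; rewrite kappaE// -[X in _ <= X + _](prob_cst mu) -ge0_integralD//.
apply: ge0_le_integral => //.
- by move=> x _; exact: integral_ge0.
- apply: (measurable_fun_fubini_tonelli_F (fun w => f (displace A w))) => //.
  exact: measurableT_comp mf (measurable_displace mA).
- exact: emeasurable_funD.
- move=> x _; have [xA|/negbTE xA] := boolP (x \in A).
    under eq_integral do rewrite displaceE xA.
    by rewrite (le_trans (fM x))// leeDl.
  under eq_integral do rewrite displaceE xA.
  by rewrite prob_cst leeDr.
Qed.

Lemma integral_displacedT_le (f : V -> \bar R) (M : \bar R) :
  measurable_fun setT f -> (forall x, 0 <= f x) -> 0 <= M -> A = setT ->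
  (forall z, \int[U]_y f (z + y)%R <= M) -> \int[kappa]_x f x <= M.
Proof.
move=> mf f0 M0 AT fM; rewrite kappaE// -[leRHS](prob_cst mu).
apply: ge0_le_integral => //.
- by move=> x _; exact: integral_ge0.
- apply: (measurable_fun_fubini_tonelli_F (fun w => f (displace A w))) => //.
  exact: measurableT_comp mf (measurable_displace mA).
- move=> x _; have xA : x \in A by rewrite AT inE.
  by under eq_integral do rewrite displaceE xA.
Qed.

Hypothesis UN : forall f : V -> \bar R, measurable_fun setT f -> (forall x, 0 <= f x) ->
  \int[U]_y f (- y)%R = \int[U]_y f y.
Variable M : \bar R.
Hypotheses (M0 : 0 <= M) (FM : forall z, \int[U]_y F (z + y)%R <= M).

Let FBM z : \int[U]_y F (z - y)%R <= M.
Proof.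
rewrite (le_trans _ (FM z))// -[leRHS]UN//.
by apply: measurableT_comp mF _; exact: measurable_rVD.
Qed.

Lemma cross_displaced : cross kappa kappa <= M + (M + cross mu mu).
Proof.
have H1 : cross kappa kappa <= M + cross kappa mu.
  rewrite /cross -[X in _ <= X + _](prob_cst kappa) -ge0_integralD//; last 2 first.
  - by move=> x _; exact: pot_ge0.
  - exact: measurable_pot.
  apply: ge0_le_integral => //.
  - by move=> x _; exact: pot_ge0.
  - exact: measurable_pot.
  - by apply: emeasurable_funD => //; exact: measurable_pot.
  - move=> x _; apply: integral_displaced_le => // [|z]; first exact: measurable_sub_l.
    by under eq_integral do rewrite opprD addrA.
rewrite (le_trans H1)// leeD2l// !crossC.
rewrite -[X in _ <= X + _](prob_cst mu) -ge0_integralD//; last 2 first.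
- by move=> x _; exact: copot_ge0.
- exact: measurable_copot.
apply: ge0_le_integral => //.
- by move=> x _; exact: copot_ge0.
- exact: measurable_copot.
- by apply: emeasurable_funD => //; exact: measurable_copot.
- move=> x _; apply: integral_displaced_le => // [|z]; first exact: measurable_sub_r.
  by under eq_integral do rewrite addrAC.
Qed.

Lemma cross_displacedT : A = setT -> cross kappa kappa <= M.
Proof.
move=> AT; rewrite /cross -[leRHS](prob_cst kappa).
apply: ge0_le_integral => //.
- by move=> x _; exact: pot_ge0.
- exact: measurable_pot.
- move=> x _; apply: integral_displacedT_le => // [|z]; first exact: measurable_sub_l.
  by under eq_integral do rewrite opprD addrA.
Qed.

End displaced_measure.

End variation.

(** * The sub-mean value property of the potential of a minimizer *)

Section sub_mean_value.
Context {R : realType} {N : nat}.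
Local Notation V := 'rV[R]_N.
Local Open Scope ereal_scope.
Variables (F : V -> \bar R) (mu U : probability V R) (M : \bar R) (e : R) (d : \bar R).
Hypotheses (mF : measurable_fun setT F) (F0 : forall x, 0 <= F x).
Hypotheses (e0 : (0 <= e)%R) (ed : e%:E < d) (U0 : U (~` eball 0%R e) = 0).
Hypothesis UN : forall f : V -> \bar R, measurable_fun setT f -> (forall x, 0 <= f x) ->
  \int[U]_y f (- y)%R = \int[U]_y f y.
Hypotheses (M0 : 0 <= M) (Moo : M < +oo) (FM : forall z, \int[U]_y F (z + y)%R <= M).
Hypothesis mu_min : forall nu : probability V R,
  dinfty mu nu < d -> cross F mu mu <= cross F nu nu.

(** Replacing mu by its average over balls of radius e gives a competitor of finite energy. *)
Lemma cross_lty : cross F mu mu < +oo.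
Proof.
have [kappa [p [cp p0 kE]]] := displacement mu e0 measurableT U0.
apply: le_lt_trans Moo; apply: le_trans (cross_displacedT mF F0 measurableT kE UN M0 FM erefl).
by apply: mu_min; rewrite (le_lt_trans (dinfty_le cp p0)).
Qed.

(** The energy of (1 - t) mu + t kappa is a quadratic polynomial in t; its derivative at t = 0 is
nonnegative by minimality. *)
Lemma cross_first_variation (A : set V) (kappa : probability V R)
    (p : probability (V * V)%type R) : measurable A ->
  couplings mu kappa p -> p (far e) = 0 ->
  (forall f : V -> \bar R, measurable_fun setT f -> (forall x, 0 <= f x) ->
    \int[kappa]_x f x = \int[mu]_x \int[U]_y f (displace A (x, y))) ->
  cross F mu mu + cross F mu mu <= cross F mu kappa + cross F kappa mu.
Proof.
move=> mA cp p0 kE.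
have Kfin : cross F mu mu \is a fin_num by rewrite ge0_fin_numE ?cross_ge0// cross_lty.
have Lfin : cross F kappa kappa \is a fin_num.
  rewrite ge0_fin_numE ?cross_ge0//.
  apply: le_lt_trans (cross_displaced mF F0 mA kE UN M0 FM) _.
  by do 2!(apply: lte_add_pinfty => //); exact: cross_lty.
have := cross_ge0 F0 kappa mu; have := cross_ge0 F0 mu kappa.
case J1E : (cross F mu kappa) => [J1| |]// _; last first.
  by case: (cross F kappa mu) => // *; rewrite leey.
case J2E : (cross F kappa mu) => [J2| |]// _; last by rewrite leey.
have [K KE] : exists K, cross F mu mu = K%:E by exists (fine (cross F mu mu)); rewrite fineK.
have [L LE] : exists L, cross F kappa kappa = L%:E.
  by exists (fine (cross F kappa kappa)); rewrite fineK.
rewrite KE -!EFinD lee_fin -[leLHS]mulr2n -mulr_natl.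
apply: (@first_order R _ _ L) => t /andP[t0 t1].
have t01 : (0 <= t <= 1)%R by rewrite ltW.
have [nu [nuE nuint]] := mixture mu kappa t01.
have := mu_min (nu := nu) (le_lt_trans (dinfty_mixture e0 t01 cp p0 (fun A _ => nuE A)) ed).
rewrite (cross_mixture mF F0 t01 nuint) J1E J2E KE LE.
by rewrite -!EFinM -!EFinD lee_fin => /le_trans -> //=; nra.
Qed.

Definition sympot (x : V) := pot F mu x + copot F mu x.

Lemma measurable_sympot : measurable_fun setT sympot.
Proof. by apply: emeasurable_funD; [exact: measurable_pot|exact: measurable_copot]. Qed.

Lemma sympot_ge0 x : 0 <= sympot x.
Proof. by rewrite adde_ge0 ?pot_ge0 ?copot_ge0. Qed.

Lemma integral_sympot (nu : probability V R) :
  \int[nu]_x sympot x = cross F nu mu + cross F mu nu.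
Proof.
rewrite ge0_integralD//; last 4 first.
- by move=> x _; exact: pot_ge0.
- exact: measurable_pot.
- by move=> x _; exact: copot_ge0.
- exact: measurable_copot.
by rewrite -crossC.
Qed.

(** Displace the points of the set A where the symmetrized potential exceeds its mean: the first
variation is the integral over A of the mean minus the potential, which would be negative if
A had positive mass. *)
Lemma sympot_sub_mean :
  {ae mu, forall x, sympot x < +oo /\ sympot x <= \int[U]_y sympot (x + y)%R}.
Proof.
pose avg x := \int[U]_y sympot (x + y)%R.
have mS := measurable_sympot; have S0 := sympot_ge0.
have mSD : measurable_fun setT (fun w : V * V => sympot (w.1 + w.2)%R).
  exact: measurableT_comp mS measurable_addrV.
have mavg : measurable_fun setT avg.
  exact: (measurable_fun_fubini_tonelli_F (fun w : V * V => sympot (w.1 + w.2)%R)).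
have avg0 x : 0 <= avg x by exact: integral_ge0.
pose A := [set x | avg x < sympot x].
have mA : measurable A by rewrite -[A]setTI; exact: measurable_lte.
have mAC : measurable (~` A) by exact: measurableC.
have Soo : \int[mu]_x sympot x < +oo.
  by rewrite integral_sympot lte_add_pinfty// cross_lty.
have [kappa [p [cp p0 kE]]] := displacement mu e0 mA U0.
have splitA f : measurable_fun setT f -> (forall x, 0 <= f x) ->
    \int[mu]_x f x = \int[mu]_(x in A) f x + \int[mu]_(x in ~` A) f x.
  move=> mf f0; rewrite -(setUv A) ge0_integral_setU ?setUv//; exact/disj_setPCl.
have mh : measurable_fun setT (fun x => if x \in A then avg x else sympot x).
  apply: measurable_fun_ifT => //; apply: (measurable_fun_bool true) => //.
  rewrite (_ : _ @^-1` _ = A) ?setTI//.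
  by apply/seteqP; split => x /=; [move/set_mem|move/mem_set].
have h0 x : 0 <= if x \in A then avg x else sympot x by case: ifP.
have SA : \int[mu]_(x in A) sympot x <= \int[mu]_(x in A) avg x.
  have := cross_first_variation mA cp p0 kE.
  rewrite [leRHS]addeC -!integral_sympot (integral_displaced kE mS S0).
  rewrite (splitA _ mS S0) (splitA _ mh h0).
  rewrite [X in _ <= X + _](_ : _ = \int[mu]_(x in A) avg x); last first.
    by apply: eq_integral => x ->.
  rewrite [X in _ <= _ + X](_ : _ = \int[mu]_(x in ~` A) sympot x); last first.
    by apply: eq_integral => x; rewrite in_setC => /negbTE ->.
  rewrite leeD2rE// ge0_fin_numE ?integral_ge0// (le_lt_trans _ Soo)//.
  exact: ge0_subset_integral.
have SAoo : \int[mu]_(x in A) sympot x < +oo.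
  by apply: le_lt_trans Soo; exact: ge0_subset_integral.
have intS : mu.-integrable A sympot.
  apply/integrableP; split; first exact: measurable_funTS.
  by under eq_integral do rewrite gee0_abs//.
have intavg : mu.-integrable A avg.
  apply/integrableP; split; first exact: measurable_funTS.
  under eq_integral do rewrite gee0_abs//.
  apply: le_lt_trans SAoo; apply: ge0_le_integral => //; try exact: measurable_funTS.
  by move=> x /ltW.
have gap0 x : A x -> 0 < sympot x - avg x by move=> Ax; rewrite sube_gt0.
have : ae_eq mu A (sympot \- avg) (cst 0).
  apply/(ae_eq_integral_abs mu mA).
    by apply: emeasurable_funB; exact: measurable_funTS.
  rewrite (eq_integral (sympot \- avg)); last first.
    by move=> x /set_mem Ax; rewrite gee0_abs// ltW// gap0.
  rewrite integralB//; apply/eqP; rewrite eq_le sube_le0 SA/=.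
  by rewrite -integralB// integral_ge0// => x Ax; rewrite ltW// gap0.
have : {ae mu, forall x, setT x -> sympot x \is a fin_num}.
  apply: integrable_ae => //; apply/integrableP; split => //.
  by under eq_integral do rewrite gee0_abs//.
apply: filterS2 => x /(_ Logic.I) Sx xA; split.
  by rewrite -ge0_fin_numE.
rewrite leNgt; apply/negP => Ax.
by have := gap0 x Ax; rewrite [_ - _](xA Ax) ltxx.
Qed.

End sub_mean_value.

(** * Approximate Laplacians of the kernel *)

Section interaction_kernel.
Context {R : realType} {N : nat}.
Local Notation V := 'rV[R]_N.
Local Notation lam := (lebesgue_rV R N).
Local Open Scope ereal_scope.
Variables (W : V -> \bar R) (k : R).
Hypotheses (mW : measurable_fun setT W) (k0 : (0 <= k)%R) (Wk : forall x, (- k)%:E <= W x).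

(** Raising the kernel by a constant changes energies and means by multiples of that constant, and
once the kernel is nonnegative Tonelli's theorem applies to its iterated integrals. *)
Definition raised (x : V) : \bar R := W x + k%:E.

Lemma raised_ge0 x : 0 <= raised x.
Proof. by rewrite /raised -leeBlDr// sub0e; exact: Wk. Qed.

Lemma measurable_raised : measurable_fun setT raised.
Proof. exact: emeasurable_funD. Qed.

Lemma interaction_energyE (nu : probability V R) :
  interaction_energy W nu = (2^-1)%:E * (cross raised nu nu - k%:E).
Proof.
have mD := @measurable_subrV R N.
rewrite /interaction_energy (@integral_shift _ _ _ _ _ _ k)//.
- congr (_ * (_ - _)).
    rewrite (fubini_tonelli1 (fun p : V * V => raised (p.1 - p.2)%R))//.
    + exact: measurableT_comp measurable_raised mD.
    + by move=> p; exact: raised_ge0.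
  by rewrite -[RHS]mule1; congr (_ * _); exact: probability_setT.
- apply: le_lt_trans (ltry 1); rewrite le_eqVlt; apply/orP; left; apply/eqP.
  exact: probability_setT.
- exact: measurableT_comp mW mD.
Qed.

Lemma cross_raised_le (mu nu : probability V R) :
  interaction_energy W mu <= interaction_energy W nu ->
  cross raised mu mu <= cross raised nu nu.
Proof. by rewrite !interaction_energyE lee_pmul2l// leeD2rE. Qed.

Variable M : R.
Hypothesis WM : forall x, \int[lam]_(y in eball x 1) W y <= M%:E.

Lemma integral_raised_eball z :
  \int[lam]_(y in eball z 1) raised y <= (M + k * fine (lam (eball 0%R 1)))%:E.
Proof.
have fin : lam (eball (0 : V) 1) \is a fin_num.
  by rewrite ge0_fin_numE// lebesgue_eball_lty.
have := WM z; rewrite (@integral_shift _ _ _ _ _ _ k)//; last 3 first.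
- exact: measurable_eball.
- by rewrite lebesgue_eball_center lebesgue_eball_lty.
- exact: measurable_funTS.
by rewrite lebesgue_eball_center -(fineK fin) -EFinM leeBlDr.
Qed.

Section uniform_mean.
Variables (e : R) (U : probability V R).
Hypotheses (e0 : (0 < e)%R) (e1 : (e < 1)%R).
Hypothesis Uint : forall f : V -> \bar R, measurable_fun setT f -> (forall x, 0 <= f x) ->
  \int[U]_x f x = ((fine (lam (eball 0%R e)))^-1)%:E * \int[lam]_(x in eball 0%R e) f x.

Let vol_gt0 : (0 < fine (lam (eball (0 : V) e)))%R.
Proof. by rewrite fine_gt0// lebesgue_eball_gt0// lebesgue_eball_lty. Qed.

Let mtrans z : measurable_fun setT (fun y : V => raised (z + y)%R).
Proof. by apply: measurableT_comp measurable_raised _; exact: measurable_rVD. Qed.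

Lemma mean_raised_le z : \int[U]_y raised (z + y)%R <=
  ((fine (lam (eball (0 : V) e)))^-1 * (M + k * fine (lam (eball (0 : V) 1))))%:E.
Proof.
rewrite Uint//; last by move=> y; exact: raised_ge0.
rewrite EFinM lee_pmul2l ?lte_fin ?invr_gt0//.
rewrite (le_trans _ (integral_raised_eball z))//.
rewrite -(integral_eball_center _ _ measurable_raised raised_ge0).
apply: ge0_subset_integral => //.
- exact: measurable_eball.
- exact: measurable_eball.
- exact: measurable_funTS.
- by move=> y _; exact: raised_ge0.
- by rewrite /eball => y /= /lt_trans ->.
Qed.

Lemma mean_raised_fin z : \int[U]_y raised (z + y)%R \is a fin_num.
Proof.
rewrite ge0_fin_numE ?(le_lt_trans (mean_raised_le z)) ?ltry//.
by apply: integral_ge0 => y _; exact: raised_ge0.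
Qed.

Lemma approx_neg_laplacianE x : approx_neg_laplacian e W x =
  (2 * (N%:R + 2) / e ^+ 2)%:E * (raised x - \int[U]_y raised (x + y)%R).
Proof.
rewrite /approx_neg_laplacian; congr (_ * _).
have fin : lam (eball (0 : V) e) \is a fin_num.
  by rewrite ge0_fin_numE// lebesgue_eball_lty.
rewrite (@integral_shift _ _ _ _ _ _ k)//; last 3 first.
- exact: measurable_eball.
- exact: lebesgue_eball_lty.
- by apply: measurable_funTS; apply: measurableT_comp mW _; exact: measurable_rVD.
have := mean_raised_fin x.
rewrite Uint//; last by move=> y; exact: raised_ge0.
have [v v0 volE] : exists2 v, (0 < v)%R & lam (eball (0 : V) e) = v%:E.
  by exists (fine (lam (eball (0 : V) e))); rewrite ?fineK ?vol_gt0.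
rewrite /raised volE/=.
have : 0 <= \int[lam]_(y in eball 0%R e) (W (x + y)%R + k%:E).
  by apply: integral_ge0 => y _; exact: raised_ge0.
case: (\int[lam]_(y in _) _) => [I| |]//= _; last first.
  by rewrite gt0_muley ?lte_fin ?invr_gt0.
have := Wk x; case: (W x) => [w| |]//= _ _.
by do ?[rewrite -EFinM | rewrite -EFinB | rewrite -EFinD]; congr EFin; field; rewrite gt_eqF.
Qed.

(** The definition of the approximate Laplacian, solved for the kernel and arranged so that every
term is nonnegative and can be integrated against mu even where the kernel is +oo. *)
Lemma raised_laplacian (C : R) x : (0 < C)%R ->
  - approx_neg_laplacian e W x < C%:E ->
  0 <= approx_neg_laplacian e W x + C%:E /\
  raised x + (C / (2 * (N%:R + 2) / e ^+ 2))%:E =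
  ((2 * (N%:R + 2) / e ^+ 2)^-1)%:E * (approx_neg_laplacian e W x + C%:E) +
  \int[U]_y raised (x + y)%R.
Proof.
move=> C0 lapC; split.
  rewrite -leeBlDr// sub0e -leeN2 oppeK; exact: ltW.
rewrite approx_neg_laplacianE.
set c := (2 * _ / _)%R.
have c0 : (0 < c)%R by rewrite divr_gt0 ?exprn_gt0// mulr_gt0// ltr_wpDl.
have := mean_raised_fin x => /fineK <-; set a := fine _.
have := raised_ge0 x; case: (raised x) => [r| |]//= _.
  by do ?[rewrite -EFinM | rewrite -EFinB | rewrite -EFinD]; congr EFin; field; rewrite gt_eqF.
by rewrite !gt0_muley ?lte_fin ?invr_gt0.
Qed.

Lemma measurable_approx_neg_laplacian :
  measurable_fun setT (approx_neg_laplacian e W).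
Proof.
rewrite (_ : approx_neg_laplacian e W = fun x => (2 * (N%:R + 2) / e ^+ 2)%:E *
    (raised x - \int[U]_y raised (x + y)%R)); last by apply/funext; exact: approx_neg_laplacianE.
apply: measurable_funeM; apply: emeasurable_funB; first exact: measurable_raised.
apply: (measurable_fun_fubini_tonelli_F (fun w : V * V => raised (w.1 + w.2)%R)).
  exact: measurableT_comp measurable_raised measurable_addrV.
by move=> w; exact: raised_ge0.
Qed.

End uniform_mean.

End interaction_kernel.

Section balances.
Local Open Scope ereal_scope.

(** The balances S_i + C / c = I_i / c + A_i between a potential S_i, the integral I_i of a shifted
Laplacian and the mean A_i of the potential are added up; all terms are finite because S_1 + S_2
is, and S_1 + S_2 cancels against A_1 + A_2. *)
Lemma balance_bound (R : realType) (A2 A1 I2 I1 S2 S1 : \bar R) (c C : R) :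
  (0 < c)%R -> 0 <= A2 -> 0 <= A1 -> 0 <= I2 -> 0 <= I1 -> 0 <= S2 -> 0 <= S1 ->
  S1 + (C / c)%:E = (c^-1)%:E * I1 + A1 ->
  S2 + (C / c)%:E = (c^-1)%:E * I2 + A2 ->
  S1 + S2 < +oo -> S1 + S2 <= A1 + A2 -> I1 <= (2 * C)%:E.
Proof.
move=> c0.
have ci : 0 < (c^-1)%:E by rewrite lte_fin invr_gt0.
case: S1 => [S1| |]//; case: S2 => [S2| |]//.
case: I1 => [I1| |]//; rewrite ?gt0_muley//; case: A1 => [A1| |]//;
case: I2 => [I2| |]//; rewrite ?gt0_muley//; case: A2 => [A2| |]//.
move=> _ _ I20 _ _ _; rewrite -!EFinM -!EFinD !lee_fin => -[H1] [H2] _ H.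
rewrite lee_fin in I20.
have : (c^-1 * I1 <= c^-1 * (2 * C))%R.
  have : (0 <= c^-1 * I2)%R by rewrite mulr_ge0// invr_ge0 ltW.
  by move: H1 H2; rewrite mulrC (mulrC _ (2 * C)%R); lra.
by rewrite ler_pM2l ?invr_gt0.
Qed.

End balances.

Section laplacian_potential.
Context {R : realType} {N : nat}.
Local Notation V := 'rV[R]_N.
Local Open Scope ereal_scope.
Variables (W : V -> \bar R) (k M e C : R) (mu U : probability V R).
Hypotheses (mW : measurable_fun setT W) (k0 : (0 <= k)%R) (Wk : forall x, (- k)%:E <= W x).
Hypothesis WM : forall x, \int[lebesgue_rV R N]_(y in eball x 1) W y <= M%:E.
Hypotheses (e0 : (0 < e)%R) (e1 : (e < 1)%R).
Hypothesis Uint : forall f : V -> \bar R, measurable_fun setT f -> (forall x, 0 <= f x) ->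
  \int[U]_x f x = ((fine (lebesgue_rV R N (eball 0%R e)))^-1)%:E *
    \int[lebesgue_rV R N]_(x in eball 0%R e) f x.
Hypothesis UN : forall f : V -> \bar R, measurable_fun setT f -> (forall x, 0 <= f x) ->
  \int[U]_y f (- y)%R = \int[U]_y f y.
Hypotheses (C0 : (0 < C)%R) (lapC : forall x, - approx_neg_laplacian e W x < C%:E).

Let F := raised W k.
Let F0 x : 0 <= F x. Proof. exact: raised_ge0. Qed.
Let mF : measurable_fun setT F. Proof. exact: measurable_raised. Qed.
Let G z := approx_neg_laplacian e W z + C%:E.
Let key z := raised_laplacian mW k0 Wk WM e0 e1 Uint C0 (lapC z).
Let G0 z : 0 <= G z. Proof. by case: (key z). Qed.
Let mG : measurable_fun setT G.
Proof.
apply: emeasurable_funD => //.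
exact: (measurable_approx_neg_laplacian mW k0 Wk WM e0 e1 Uint).
Qed.
Let c : R := (2 * (N%:R + 2) / e ^+ 2)%R.

Lemma integral_raised_laplacian (phi : V -> V) : measurable_fun setT phi ->
  \int[mu]_y F (phi y) + (C / c)%:E =
  (c^-1)%:E * \int[mu]_y G (phi y) + \int[mu]_y \int[U]_z F (phi y + z)%R.
Proof.
move=> mphi.
have c0 : (0 < c)%R by rewrite divr_gt0 ?exprn_gt0// mulr_gt0// ltr_wpDl.
have mFz : measurable_fun setT (fun w : V * V => F (phi w.1 + w.2)%R).
  apply: (measurableT_comp mF); apply: measurable_rVD; last exact: measurable_snd.
  exact: measurableT_comp mphi measurable_fst.
rewrite -[X in _ + X = _](prob_cst mu) -ge0_integralD//; last 2 first.
- exact: measurableT_comp mF mphi.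
- by move=> y _; rewrite lee_fin divr_ge0 ?ltW.
under eq_integral do rewrite (key _).2.
rewrite ge0_integralD//; last 4 first.
- by move=> y _; rewrite mule_ge0 ?lee_fin ?invr_ge0 ?(ltW c0)//; exact: G0.
- by apply: measurable_funeM; exact: measurableT_comp mG mphi.
- by move=> y _; apply: integral_ge0.
- exact: (measurable_fun_fubini_tonelli_F (fun w : V * V => F (phi w.1 + w.2)%R)).
congr (_ + _); rewrite ge0_integralZl//.
- exact: measurableT_comp mG mphi.
- by move=> y _; exact: G0.
- by rewrite lee_fin invr_ge0 ltW.
Qed.

(** Integrating raised_laplacian along y -> x - y and along y -> y - x and adding the results, the
symmetrized potential appears on one side and its mean on the other. What is left bounds the
integrals of the two shifted Laplacians by 2 C in total. *)
Lemma integral_laplacian_le x :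
  sympot F mu x < +oo -> sympot F mu x <= \int[U]_y sympot F mu (x + y)%R ->
  \int[mu]_y (approx_neg_laplacian e W (x - y)%R + C%:E) <= (2 * C)%:E.
Proof.
move=> Soo Sle.
have c0 : (0 < c)%R by rewrite divr_gt0 ?exprn_gt0// mulr_gt0// ltr_wpDl.
have H1 := @integral_raised_laplacian (fun y => x - y)%R
  (measurable_rVB (measurable_cst x) (@measurable_id _ _ _)).
have H2 := @integral_raised_laplacian (fun y => y - x)%R
  (measurable_rVB (@measurable_id _ _ _) (measurable_cst x)).
have mx : measurable_fun setT (fun z : V => x + z)%R by exact: measurable_rVD.
have E1 : \int[mu]_y \int[U]_z F (x - y + z)%R = \int[U]_z pot F mu (x + z)%R.
  transitivity (\int[U]_z \int[mu]_y F (x - y + z)%R).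
    apply: (fubini_tonelli (fun w : V * V => F (x - w.1 + w.2)%R)) => //.
    apply: (measurableT_comp mF); apply: measurable_rVD; last exact: measurable_snd.
    by apply: measurable_rVB => //; exact: measurable_fst.
  by apply: eq_integral => z _; apply: eq_integral => y _; rewrite addrAC.
have E2 : \int[mu]_y \int[U]_z F (y - x + z)%R = \int[U]_z copot F mu (x + z)%R.
  transitivity (\int[mu]_y \int[U]_z F (y - (x + z))%R).
    apply: eq_integral => y _; rewrite -UN//; last first.
      by apply: (measurableT_comp mF); exact: measurable_rVD.
    by apply: eq_integral => z _; rewrite opprD addrA.
  apply: (fubini_tonelli (fun w : V * V => F (w.1 - (x + w.2))%R)) => //.
  apply: (measurableT_comp mF); apply: measurable_rVB; first exact: measurable_fst.
  by apply: measurable_rVD => //; exact: measurable_snd.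
have ES : \int[U]_z sympot F mu (x + z)%R =
    \int[U]_z pot F mu (x + z)%R + \int[U]_z copot F mu (x + z)%R.
  rewrite ge0_integralD//.
  - by move=> z _; exact: pot_ge0.
  - exact: measurableT_comp (measurable_pot mF F0 mu) mx.
  - by move=> z _; exact: copot_ge0.
  - exact: measurableT_comp (measurable_copot mF F0 mu) mx.
move: H1 H2 Soo Sle; rewrite E1 E2 ES /sympot /pot /copot -/(G _).
have : 0 <= \int[mu]_y F (x - y)%R by exact: integral_ge0.
have : 0 <= \int[mu]_y F (y - x)%R by exact: integral_ge0.
have : 0 <= \int[mu]_y G (x - y)%R by apply: integral_ge0 => y _; exact: G0.
have : 0 <= \int[mu]_y G (y - x)%R by apply: integral_ge0 => y _; exact: G0.
have : 0 <= \int[U]_z \int[mu]_y F (x + z - y)%R.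
  by apply: integral_ge0 => z _; exact: integral_ge0.
have : 0 <= \int[U]_z \int[mu]_y F (y - (x + z))%R.
  by apply: integral_ge0 => z _; exact: integral_ge0.
rewrite -/(G _).
move: (\int[U]_z \int[mu]_y F (y - (x + z))%R) (\int[U]_z \int[mu]_y F (x + z - y)%R)
  (\int[mu]_y G (y - x)%R) (\int[mu]_y G (x - y)%R) (\int[mu]_y F (y - x)%R)
  (\int[mu]_y F (x - y)%R).
move=> A2 A1 I2 I1 S2 S1.
exact: (@balance_bound R A2 A1 I2 I1 S2 S1 c C c0).
Qed.

End laplacian_potential.

(** * The generalized Laplacian *)

Section lower_limits.
Context {R : realType}.
Local Open Scope ereal_scope.

Lemma limn_einf_shiftn (u : (\bar R)^nat) (n0 : nat) :
  limn_einf (fun n => u (n + n0)%N) = limn_einf u.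
Proof.
rewrite !limn_einf_lim.
have -> : einfs (fun n => u (n + n0)%N) = (fun n => einfs u (n + n0)%N).
  apply/funext => n; rewrite /einfs/=; congr ereal_inf.
  apply/seteqP; split => _ [m /= nm <-].
    by exists (m + n0)%N => //=; rewrite leq_add2r.
  have n0m : (n0 <= m)%N by rewrite (leq_trans _ nm)// leq_addl.
  by exists (m - n0)%N; rewrite /= ?subnK// leq_subRL// addnC.
have : einfs u (n + n0)%N @[n --> \oo] --> limn (einfs u).
  rewrite (cvg_shiftn n0 (einfs u)); exact: is_cvg_einfs.
exact: cvg_lim.
Qed.

Lemma limn_einf_le (u : (\bar R)^nat) (M : \bar R) :
  (forall n, u n <= M) -> limn_einf u <= M.
Proof.
move=> uM; rewrite limn_einf_lim; apply: lime_le; first exact: is_cvg_einfs.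
apply: nearW => n; apply: le_trans (uM n); apply: ereal_inf_lbound.
by exists n => /=.
Qed.

Lemma measurable_limn_einf d (T : measurableType d) (f : (T -> \bar R)^nat) :
  (forall n, measurable_fun setT (f n)) ->
  measurable_fun setT (fun x => limn_einf (f ^~ x)).
Proof.
move=> mf; apply: (emeasurable_fun_cvg (fun n x => einfs (f ^~ x) n)).
  by move=> n; exact: measurable_fun_einfs.
move=> x _; rewrite limn_einf_lim; exact: is_cvg_einfs.
Qed.

End lower_limits.

Section generalized_laplacian.
Context {R : realType} {N : nat}.
Local Notation V := 'rV[R]_N.
Local Open Scope ereal_scope.
Variables (W : V -> \bar R) (k M C : R).
Hypotheses (mW : measurable_fun setT W) (k0 : (0 <= k)%R) (Wk : forall x, (- k)%:E <= W x).
Hypothesis WM : forall x, \int[lebesgue_rV R N]_(y in eball x 1) W y <= M%:E.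
Hypotheses (C0 : (0 < C)%R) (lapC : forall x (e : R), (0 < e < 1)%R ->
  - approx_neg_laplacian e W x < C%:E).

Lemma measurable_approx_neg_laplacian_lt1 (e : R) : (0 < e < 1)%R ->
  measurable_fun setT (approx_neg_laplacian e W).
Proof.
move=> /andP[e0 e1]; have [U [_ Uint _]] := uniform_eball (N := N) e0.
exact: (measurable_approx_neg_laplacian mW k0 Wk WM e0 e1 Uint).
Qed.

Let small n : (0 < (n.+2%:R^-1 : R) < 1)%R.
Proof. by rewrite invr_gt0 ltr0n invf_lt1// ltr1n. Qed.

Lemma neg_laplacian0_shift z : neg_laplacian0 W z + C%:E =
  limn_einf (fun n => approx_neg_laplacian (n.+1%:R^-1) W z + C%:E).
Proof.
under eq_fun do rewrite addeC.
by rewrite limn_einf_shift// addeC.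
Qed.

Lemma neg_laplacian0_ge0 z : 0 <= neg_laplacian0 W z + C%:E.
Proof.
(* The sequence starts with radius 1, while the lower bound -C holds for radii below 1. *)
rewrite neg_laplacian0_shift -(limn_einf_shiftn _ 1) limn_einf_lim.
apply: lime_ge; first exact: is_cvg_einfs.
apply: nearW => n; apply: le_ereal_inf_tmp => _ [m /= nm <-].
rewrite -leeBlDr// sub0e -leeN2 oppeK; apply: ltW; rewrite addn1; exact: lapC.
Qed.

Lemma measurable_neg_laplacian0 :
  measurable_fun setT (fun z => neg_laplacian0 W z + C%:E).
Proof.
under eq_fun do rewrite neg_laplacian0_shift -(limn_einf_shiftn _ 1).
apply: measurable_limn_einf => n; apply: emeasurable_funD => //.
by rewrite addn1; exact: measurable_approx_neg_laplacian_lt1.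
Qed.

(** The radius 1 / (n + 1) must be less than the d_oo radius of minimality and less than 1, hence
the shift by n0 in the sequence to which Fatou's lemma is applied. *)
Lemma minimizer_laplacian_le (mu : probability V R) : dinfty_local_minimizer W mu ->
  {ae mu, forall x, \int[mu]_y (neg_laplacian0 W (x - y)%R + C%:E) <= (2 * C)%:E}.
Proof.
move=> [d d0 mu_min].
have [n0 n0P] : exists n0 : nat, forall n,
    ((n + n0).+1%:R^-1 < d /\ 0 < ((n + n0).+1%:R^-1 : R) < 1)%R.
  exists (Num.truncn d^-1).+1 => n; rewrite addnS; split; last exact: small.
  rewrite -[ltRHS]invrK ltf_pV2 ?posrE ?invr_gt0//.
  by rewrite (lt_le_trans (truncnS_gt _))// ler_nat ltnS leqW// leq_addl.
pose D n z := approx_neg_laplacian (n + n0).+1%:R^-1 W z + C%:E.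
have aeD : {ae mu, forall x, forall n, \int[mu]_y D n (x - y)%R <= (2 * C)%:E}.
  apply/ae_foralln => n.
  have [nd /[dup] e01 /andP[e0 e1]] := n0P n.
  have [U [U0 Uint UN]] := uniform_eball (N := N) e0.
  have mF := measurable_raised k mW.
  have F0 := raised_ge0 Wk.
  set m := ((fine (lebesgue_rV R N (eball (0 : V) (n + n0).+1%:R^-1)))^-1 *
    (M + k * fine (lebesgue_rV R N (eball (0 : V) 1))))%R.
  have mean := mean_raised_le mW k0 Wk WM e0 e1 Uint.
  have m0 : 0 <= m%:E.
    by apply: le_trans (mean 0%R); apply: integral_ge0 => y _; exact: F0.
  have ed : (n + n0).+1%:R^-1%:E < d%:E by rewrite lte_fin.
  have min nu : dinfty mu nu < d%:E -> cross (raised W k) mu mu <= cross (raised W k) nu nu.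
    by move=> /mu_min; exact: cross_raised_le.
  have := sympot_sub_mean mF F0 (ltW e0) ed U0 UN m0 (ltry _) mean min.
  apply: filterS => x [Soo Sle].
  apply: (integral_laplacian_le mW k0 Wk WM e0 e1 Uint UN C0 _ Soo Sle).
  by move=> z; exact: lapC.
apply: filterS aeD => x Dx.
have mD n : measurable_fun setT (fun y : V => D n (x - y)%R).
  apply: emeasurable_funD => //.
  apply: measurableT_comp (measurable_approx_neg_laplacian_lt1 (n0P n).2) _.
  exact: measurable_rVB.
have D0 n y : 0 <= D n (x - y)%R.
  rewrite /D -leeBlDr// sub0e -leeN2 oppeK; apply: ltW; apply: lapC; exact: (n0P n).2.
rewrite (eq_integral (fun y : V => limn_einf (fun n => D n (x - y)%R))); last first.
  by move=> y _; rewrite neg_laplacian0_shift -(limn_einf_shiftn _ n0).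
apply: (le_trans (fatou mu measurableT mD (fun n y _ => D0 n y))).
exact: limn_einf_le.
Qed.

End generalized_laplacian.

(** * From a singular potential to Hausdorff dimension *)

Section frostman.
Context {R : realType} {N : nat}.
Local Notation V := 'rV[R]_N.
Local Open Scope ereal_scope.

(** Chebyshev's inequality: on the ball of radius r around x the integrand is at least c / r^beta.
For r = 0 it is +oo, so that mu has no atom at x. *)
Lemma frostman (mu : probability V R) (h : V -> \bar R) (beta eps c B : R) (x : V) (r : R) :
  measurable_fun setT h -> (forall z, 0 <= h z) ->
  (0 < beta)%R -> (0 < c)%R ->
  (forall z : V, (0 < enorm z < eps)%R -> (c / enorm z `^ beta)%:E <= h z) ->
  h 0%R = +oo ->
  \int[mu]_y h (x - y)%R <= B%:E -> (0 <= r < eps)%R ->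
  mu (cball x r) <= (B / c * r `^ beta)%:E.
Proof.
move=> mh h0 beta0 c0 hc hoo hB /andP[r0 reps].
have mball := @measurable_cball R N x r.
have mhx : measurable_fun setT (fun y : V => h (x - y)%R).
  by apply: measurableT_comp mh _; exact: measurable_rVB.
have lower (v : \bar R) : 0 <= v -> (forall y, cball x r y -> v <= h (x - y)%R) ->
    v * mu (cball x r) <= B%:E.
  move=> v0 vh; rewrite -integral_cst//; apply: le_trans hB.
  apply: (@le_trans _ _ (\int[mu]_(y in cball x r) h (x - y)%R)).
    by apply: ge0_le_integral => //; exact: measurable_funTS.
  exact: ge0_subset_integral.
have fin : mu (cball x r) \is a fin_num by exact: fin_num_measure.
move: r0; rewrite le_eqVlt => /predU1P[r0|r0].
  rewrite -r0 powR0 ?gt_eqF// mulr0.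
  have := lower +oo (leey _); rewrite -r0.
  have [->//|mu0] := eqVneq (mu (cball x 0%R)) 0.
  rewrite gt0_mulye ?lt0e ?mu0//= => H.
  suff : +oo <= B%:E by [].
  apply: H => y; rewrite /cball/= => yx.
  have /enorm_eq0/eqP : enorm (y - x) = 0%R by apply/eqP; rewrite eq_le yx enorm_ge0.
  by rewrite subr_eq0 => /eqP ->; rewrite subrr hoo.
have rb : (0 < r `^ beta)%R by exact: powR_gt0.
have : (c / r `^ beta)%:E * mu (cball x r) <= B%:E.
  apply: lower; first by rewrite lee_fin divr_ge0 ?ltW.
  move=> y; rewrite /cball/= => yx.
  have [xy|xy] := eqVneq (enorm (x - y)) 0%R.
    by rewrite (enorm_eq0 xy) hoo leey.
  have xy0 : (0 < enorm (x - y))%R by rewrite lt_def xy enorm_ge0.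
  have xyr : (enorm (x - y) <= r)%R by rewrite enormBC.
  apply: (le_trans _ (hc _ _)); last by rewrite xy0 (le_lt_trans xyr).
  rewrite lee_fin ler_pM2l// lef_pV2 ?posrE ?powR_gt0//.
  by rewrite ge0_ler_powR// ?nnegrE ltW.
rewrite -(fineK fin) -EFinM !lee_fin => H.
rewrite -(ler_pM2l (divr_gt0 c0 rb)) (le_trans H)// le_eqVlt; apply/orP; left.
by apply/eqP; field; rewrite !gt_eqF.
Qed.

End frostman.

Section mass_distribution.
Context {R : realType} {N : nat}.
Local Notation V := 'rV[R]_N.
Local Open Scope ereal_scope.
Implicit Types rho : {measure set V -> \bar R}.

(** A point off the support has a null neighbourhood, which contains a null cube with rational
centre around that point; there are countably many such cubes. *)
Lemma negligible_supp_compl rho : rho.-negligible (~` supp rho).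
Proof.
pose B (q : 'rV[rat]_N * nat) : set V :=
  [set x : V | forall i, ball (ratr (q.1 ord0 i) : R) q.2.+1%:R^-1%R (x ord0 i)].
have mB q : measurable (B q).
  apply: (@measurable_box _ _ (fun i => ball (ratr (q.1 ord0 i) : R) q.2.+1%:R^-1%R)) => i.
  by apply: open_measurable; exact: ball_open.
pose F n : set V := if unpickle n is Some q then
  (if rho (B q) == 0 then B q else set0) else set0.
suff : rho.-negligible (\bigcup_n F n).
  apply: negligibleS => x /= xsupp.
  have [e [e0 /eqP rho0]] : exists e : R, (0 < e)%R /\ rho (eball x e) == 0.
    apply: contrapT => noe; apply: xsupp => e e0; rewrite lt0e measure_ge0 andbT.
    by apply/negP => rho0; apply: noe; exists e.
  (* A cube of half-side 1 / (n + 1) that contains x lies in the ball of radius e around x, as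
  each coordinate varies in it by at most 2 / (n + 1). *)
  pose n := Num.truncn (2 * N.+1%:R / e).
  have n0 : (0 < n.+1%:R^-1 :> R)%R by rewrite invr_gt0.
  have ne : (n.+1%:R^-1 * 2 * N.+1%:R < e)%R.
    rewrite -mulrA mulrC ltr_pdivrMr// (mulrC e) -ltr_pdivrMr//; exact: truncnS_gt.
  have Hq i : exists q : rat, ball (ratr q : R) n.+1%:R^-1%R (x ord0 i).
    have /rat_in_itvoo[q] : (x ord0 i - n.+1%:R^-1 < x ord0 i + n.+1%:R^-1)%R.
      by rewrite ltrBlDr -addrA ltrDl addr_gt0.
    by rewrite in_itv/= -ltr_distl => ?; exists q.
  have [q Pq] := choice Hq.
  pose Q : 'rV[rat]_N * nat := (\row_i q i, n).
  exists (pickle Q) => //; rewrite /F pickleK.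
  have BQe : B Q `<=` eball x e.
    move=> y By; rewrite /eball/= (le_lt_trans (enorm_le_sum _))//.
    apply: le_lt_trans ne.
    have coordle i : (`|(y - x) ord0 i| <= n.+1%:R^-1 * 2)%R.
      have := By i; have := Pq i; rewrite /Q/= mxE /ball/= !mxE => qx qy.
      rewrite (le_trans (ler_distD (ratr (q i)) _ _))// mulr_natr mulr2n.
      by rewrite lerD// ltW// distrC.
    apply: (le_trans (ler_sum _ (fun i _ => coordle i))).
    by rewrite sumr_const card_ord -[(_ *+ N)%R]mulr_natr ler_wpM2l ?ler_nat//.
  have -> : rho (B Q) == 0.
    apply/eqP; apply: (subset_measure0 (mB Q) (measurable_eball x e) BQe).
    exact: rho0.
  by move=> i; rewrite /Q/= mxE.
apply: negligible_bigcup => n; rewrite /F.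
case: unpickle => [q|]; last exact: negligible_set0.
case: eqP => [B0|_]; last exact: negligible_set0.
exact/negligibleP.
Qed.

(** A cover of the support by sets U_i of small diameter covers almost all of the good set G by
the balls centred at a point of G in U_i with radius the diameter of U_i, whose masses add up
to at most c times the sum of diam(U_i)^s. So this sum cannot be less than rho(R^N) / c. *)
Lemma mass_distribution rho (s c eps : R) (G : set V) :
  0 < rho setT < +oo -> (0 <= s)%R -> (0 <= c)%R -> (0 < eps)%R ->
  rho.-negligible (~` G) ->
  (forall x r, G x -> (0 <= r < eps)%R -> rho (cball x r) <= (c * r `^ s)%:E) ->
  hausdorff_measure s (supp rho) != 0.
Proof.
move=> /andP[rho0 rhooo] s0 c0 eps0 Gnull Gr; apply/eqP => H0.
have [m m0 rhom] : exists2 m, (0 < m)%R & rho setT = m%:E.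
  exists (fine (rho setT)); first by rewrite fine_gt0// rho0.
  by rewrite fineK// ge0_fin_numE.
(* The cover has diameters at most d, and the radii of the balls must be less than eps. *)
pose d := (eps / 2)%R.
have d0 : (0 < d)%R by rewrite divr_gt0.
(* c + 1 replaces c, which may vanish, to get c * eta < m. *)
pose eta := (m / (c + 1))%R.
have eta0 : (0 < eta)%R by rewrite divr_gt0// ltr_wpDl.
have : hausdorff_content s d (supp rho) < eta%:E.
  apply: (@le_lt_trans _ _ 0); last by rewrite lte_fin.
  by rewrite -H0; apply: ereal_sup_ubound; exists d.
move=> /ereal_inf_lt[_ [U [Ucov Ud] <-]] Ueta.
pose meets i := exists x, U i x /\ G x.
have /choice[x xP] : forall i, exists x : V, meets i -> U i x /\ G x.
  by move=> i; have [[x xi]|nm] := pselect (meets i); [exists x|exists 0%R].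
pose T i : set V := if `[< meets i >] then cball (x i) (fine (diam (U i))) else set0.
have mT i : measurable (T i).
  by rewrite /T; case: asboolP => _; [exact: measurable_cball|exact: measurable0].
have diamE i : meets i -> exists2 r, (0 <= r < eps)%R & diam (U i) = r%:E.
  move=> /xP[Ux _]; have r0 : 0 <= diam (U i).
    apply: ereal_sup_ubound; exists (x i, x i) => //=.
    by rewrite subrr enorm0.
  have := Ud i; case: (diam (U i)) r0 => [r| |]//; rewrite !lee_fin => r0 rd.
  by exists r => //; rewrite r0 (le_lt_trans rd)// ltr_pdivrMr// mulr_natr mulr2n ltrDl.
have diam_pow_ge0 i : 0 <= diam_pow s (U i).
  by rewrite /diam_pow; case: ifP => // _; exact: poweR_ge0.
have rhoT i : rho (T i) <= c%:E * diam_pow s (U i).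
  rewrite /T; case: asboolP => [mi|_]; last by rewrite measure0 mule_ge0.
  have [r r0 rE] := diamE i mi; have [Ux Gx] := xP i mi.
  rewrite /diam_pow ifF ?rE; last first.
    by apply/negP => /eqP U0; move: Ux; rewrite U0.
  by rewrite poweR_EFin -EFinM; exact: Gr.
have [Z [mZ Z0 subZ]] := negligibleU (negligible_supp_compl rho) Gnull.
have cov : setT `<=` Z `|` \bigcup_i T i.
  move=> y _; have [Zy|nZ] := pselect (Z y); [by left|right].
  have [suppy Gy] : supp rho y /\ G y.
    by split; apply: contrapT => ny; apply: nZ; apply: subZ; [left|right].
  have [i _ Uy] := Ucov y suppy.
  have mi : meets i by exists y.
  exists i => //; rewrite /T asboolT// /cball/=.
  have [r _ rE] := diamE i mi; rewrite rE -lee_fin -rE.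
  apply: ereal_sup_ubound; exists (y, x i) => //=; split => //=.
  exact: (xP i mi).1.
have mTT : measurable (\bigcup_i T i) by exact: bigcupT_measurable.
have : rho setT < m%:E.
  apply: (@le_lt_trans _ _ (rho (Z `|` \bigcup_i T i))).
    by apply: le_measure; rewrite ?inE//; exact: measurableU.
  apply: (le_lt_trans (measureU2 rho mZ mTT)); rewrite [X in X + _]Z0 add0e.
  apply: (@le_lt_trans _ _ (\sum_(0 <= i <oo) rho (T i))).
    exact: measure_sigma_subadditive.
  apply: (@le_lt_trans _ _ (c%:E * \sum_(0 <= i <oo) diam_pow s (U i))).
    by rewrite -nneseriesZl//; apply: lee_nneseries => // i _ _; exact: measure_ge0.
  apply: (@le_lt_trans _ _ (c%:E * eta%:E)).
    by apply: lee_wpmul2l; [rewrite lee_fin|exact: ltW].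
  rewrite -EFinM lte_fin /eta mulrCA gtr_pMr// ltr_pdivrMr ?mul1r ?ltrDl//.
  by rewrite ltr_wpDl.
by rewrite rhom ltxx.
Qed.

End mass_distribution.

Theorem theorem1 (R : realType) (N : nat) (W : 'rV[R]_N -> \bar R)
    (hWrange : forall x, W x != -oo%E)
    (hWbounded : exists m : R, forall x, (m%:E <= W x)%E)
    (hWlsc : lower_semicontinuous W)
    (hWint : exists2 M : R, 0 < M &
       forall x, (\int[lebesgue_rV R N]_(y in eball x 1) W y <= M%:E)%E)
    (hWlap : exists2 C : R, 0 < C & forall (x : 'rV[R]_N) (e : R),
       0 < e < 1 -> (- approx_neg_laplacian e W x < C%:E)%E)
    (mu : probability 'rV[R]_N R)
    (hmucompact : compact (supp mu))
    (hmumin : dinfty_local_minimizer W mu)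
    (beta : R) (hbeta : 0 < beta < N%:R)
    (hrep : beta_repulsive beta W)
    (rho : {measure set 'rV[R]_N -> \bar R}) (hrho : is_part rho mu) :
  (beta%:E <= hausdorff_dim (supp rho))%E.
Proof.
have [m Wm] := hWbounded; have [M _ WM] := hWint; have [C C0 lapC] := hWlap.
have /andP[beta0 _] := hbeta.
have [[mW _] [eps [c [eps0 c0 Wc]]] W0] := hrep.
have [[A mA rhoA] rhomu] := hrho.
have Wk x : ((- `|m|)%:E <= W x)%E.
  by rewrite (le_trans _ (Wm x))// lee_fin lerNl ler_normr lexx orbT.
pose h z := (neg_laplacian0 W z + C%:E)%E.
have h0 z : (0 <= h z)%E by exact: neg_laplacian0_ge0 lapC z.
have mh : measurable_fun setT h.
  exact: (measurable_neg_laplacian0 C mW (normr_ge0 m) Wk WM).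
have hc (z : 'rV[R]_N) : 0 < enorm z < eps -> ((c / enorm z `^ beta)%:E <= h z)%E.
  by move=> /Wc /le_trans; apply; rewrite leeDl// lee_fin ltW.
have hoo : h 0 = +oo%E by rewrite /h W0.
have [Z [mZ Z0 subZ]] := minimizer_laplacian_le mW (normr_ge0 m) Wk WM C0 lapC hmumin.
pose G := [set x | (\int[mu]_y h (x - y)%R <= (2 * C)%:E)%E].
have Gnull : rho.-negligible (~` G).
  exists Z; split => //.
  by apply/eqP; rewrite eq_le measure_ge0 andbT -Z0 rhomu.
have rho0 : (0 < rho setT < +oo)%E.
  rewrite (le_lt_trans (rhomu _ measurableT)) ?probability_setT ?ltry// andbT.
  apply: (@lt_le_trans _ _ (rho A)); first by rewrite lt0e rhoA measure_ge0.
  by apply: le_measure; rewrite ?inE.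
apply: le_ereal_inf_tmp => _ [s [s0 Hs] <-]; rewrite lee_fin leNgt; apply/negP => sbeta.
have : hausdorff_measure s (supp rho) != 0%E.
  have K0 : 0 <= 2 * C / c by rewrite divr_ge0 ?mulr_ge0 ?ltW.
  apply: (@mass_distribution _ _ rho s (2 * C / c) (Num.min eps 1) G) => //.
    by rewrite lt_min eps0 ltr01.
  move=> x r Gx /andP[r0]; rewrite lt_min => /andP[reps r1].
  apply: le_trans (rhomu _ (measurable_cball x r)) _.
  apply: le_trans (frostman mh h0 beta0 c0 hc hoo Gx _) _; first by rewrite r0.
  rewrite lee_fin ler_wpM2l//.
  (* Balls of radius below 1: lowering the exponent enlarges the bound. *)
  move: r0; rewrite le_eqVlt => /predU1P[<-|r0].
    by rewrite powR0 ?gt_eqF// powR_ge0.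
  by rewrite ger_powR ?r0 ?ltW.
by rewrite Hs eqxx.
Qed.
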